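(* Let $\mathcal V$ be a regular descent category, $k$ a positive integer, and $X$ a regular $k$-category in $\mathcal V$. For $n\ge0$ let $\mathcal G(X)_n$ be the image (the codomain of the coimage) of the regular morphism $\mathrm{Map}(\boldsymbol\Delta^n,X)\to\mathrm{Map}(\Delta^n,X)=X_n$ induced by $\Delta^n\subset\boldsymbol\Delta^n$. Then the objects $\mathcal G(X)_n$ form a simplicial space (with structure maps induced from $X$), this simplicial space is a $k$-groupoid, and the induced morphism $\mathbb G(X)\to\mathcal G(X)$ is a hypercover, where $\mathbb G(X)_n=\mathrm{Map}(\boldsymbol\Delta^n,X)$.
   Context: A descent category is a small category $\mathcal V$ with a subcategory of morphisms called covers such that: $\mathcal V$ has finite limits; pullbacks of covers are covers; if $f$ and $g\circ f$ are covers then $g$ is a cover. The coimage of $f:X\to Y$ is the coequalizer $p:X\to Z$ (if it exists) of the two projections $X\times_YX\rightrightarrows X$; the image is the induced $i:Z\to Y$. It is subcanonical if every cover is an effective epimorphism (i.e. its image is an isomorphism). A regular descent category is a subcanonical descent category with a subcategory of regular morphisms such that every cover is regular, pullbacks of regular morphisms are regular, and every regular morphism has a coimage which is a cover. A simplicial space is a simplicial object in $\mathcal V$; $\mathrm{Map}(T,X)$ is the limit representing simplicial maps $T\to X$ (for $k$-categories it equals the finite limit $\mathrm{Map}(\mathrm{sk}_{k+1}T,X)$); for $f:X\to Y$ and $S\subset T$, $\mathrm{Map}(S\hookrightarrow T,f)=\mathrm{Map}(S,X)\times_{\mathrm{Map}(S,Y)}\mathrm{Map}(T,Y)$. $\Lambda^n_i=\bigcup_{j\ne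 i}\partial_j\Delta^n$. The thick simplex $\boldsymbol\Delta^n$ is the nerve of the groupoid on $\{0,\dots,n\}$ with exactly one morphism between any two objects ($m$-simplices: all functions $\{0,..,m\}\to\{0,..,n\}$; $\Delta^n$ = the monotone ones). A $k$-category is a simplicial space $X$ with $X_n\to\mathrm{Map}(\Lambda^n_i,X)$ a cover for $0<i<n$ and an isomorphism for $n>k$, and $\mathrm{Map}(\boldsymbol\Delta^1,X)\to X_0$ (restriction to a vertex) a cover; it is regular if $\mathrm{Map}(\boldsymbol\Delta^1,X)\to X_1$ is regular. A $k$-groupoid is a simplicial space with $X_n\to\mathrm{Map}(\Lambda^n_i,X)$ a cover for all $n>0$, $0\le i\le n$, and an isomorphism for $n>k$. A morphism $f:X\to Y$ is a hypercover if $X_n\to\mathrm{Map}(\partial\Delta^n\hookrightarrow\Delta^n,f)$ is a cover for all $n\ge0$. (That $\mathrm{Map}(\boldsymbol\Delta^n,X)\to X_n$ is regular is part of the setting.) *)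

(* Defs.v *)
From mathcomp Require Import all_boot.
Set Implicit Arguments. Unset Strict Implicit. Unset Printing Implicit Defensive.

Record category := MkCat {
  ob :> Type;
  hom : ob -> ob -> Type;
  idm : forall a, hom a a;
  compm : forall a b c, hom b c -> hom a b -> hom a c;
  comp_idl : forall a b (f : hom a b), compm (idm b) f = f;
  comp_idr : forall a b (f : hom a b), compm f (idm a) = f;
  comp_assoc : forall a b c d (h : hom c d) (g : hom b c) (f : hom a b),
      compm h (compm g f) = compm (compm h g) f }.
Arguments hom {c0} _ _.
Arguments idm {c0} a.
Arguments compm {c0 a b c} _ _.

Section CatDefs.
Variable C : category.

Definition is_iso (a b : C) (f : hom a b) : Prop :=
  exists g : hom b a, compm g f = idm a /\ compm f g = idm b.

Definition is_pullback (a b c P : C) (f : hom a c) (g : hom b c)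
  (p1 : hom P a) (p2 : hom P b) : Prop :=
  compm f p1 = compm g p2 /\
  forall (Q : C) (q1 : hom Q a) (q2 : hom Q b), compm f q1 = compm g q2 ->
    exists! h : hom Q P, compm p1 h = q1 /\ compm p2 h = q2.

Definition is_terminal (t : C) : Prop := forall a : C, exists! h : hom a t, True.

Definition has_finite_limits : Prop :=
  (exists t : C, is_terminal t) /\
  forall (a b c : C) (f : hom a c) (g : hom b c),
    exists (P : C) (p1 : hom P a) (p2 : hom P b), is_pullback f g p1 p2.

Definition is_coequalizer (K x z : C) (u v : hom K x) (p : hom x z) : Prop :=
  compm p u = compm p v /\
  forall (Q : C) (q : hom x Q), compm q u = compm q v ->
    exists! r : hom z Q, compm r p = q.

Definition is_coimage (x y z : C) (f : hom x y) (p : hom x z) : Prop :=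
  exists (K : C) (pi1 pi2 : hom K x), is_pullback f f pi1 pi2 /\ is_coequalizer pi1 pi2 p.

Definition morclass := forall a b : C, hom a b -> Prop.

Definition wide_subcat (W : morclass) : Prop :=
  (forall a, W a a (idm a)) /\
  (forall a b c (g : hom b c) (f : hom a b), W _ _ f -> W _ _ g -> W _ _ (compm g f)).

Definition pullback_stable (W : morclass) : Prop :=
  forall (a b c P : C) (f : hom a c) (g : hom b c) (p1 : hom P a) (p2 : hom P b),
    W _ _ f -> is_pullback f g p1 p2 -> W _ _ p2.

Definition descent_category (cov : morclass) : Prop :=
  has_finite_limits /\ wide_subcat cov /\ pullback_stable cov /\
  (forall a b c (f : hom a b) (g : hom b c), cov _ _ f -> cov _ _ (compm g f) -> cov _ _ g).

Definition subcanonical (cov : morclass) : Prop :=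
  forall a b (f : hom a b), cov _ _ f ->
    exists (z : C) (p : hom a z) (i : hom z b),
      is_coimage f p /\ compm i p = f /\ is_iso i.

Definition regular_descent_category (cov reg : morclass) : Prop :=
  descent_category cov /\ subcanonical cov /\ wide_subcat reg /\
  (forall a b (f : hom a b), cov _ _ f -> reg _ _ f) /\
  pullback_stable reg /\
  (forall a b (f : hom a b), reg _ _ f ->
     exists (z : C) (p : hom a z), is_coimage f p /\ cov _ _ p).

End CatDefs.

(** * Simplices: m-simplices of the thick simplex are all maps [m] -> [n] *)
Definition mono a b (t : {ffun 'I_a -> 'I_b}) : bool :=
  [forall i : 'I_a, forall j : 'I_a, (i <= j) ==> (t i <= t j)].
Definition fcomp a b c (t : {ffun 'I_b -> 'I_c}) (s : {ffun 'I_a -> 'I_b})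
  : {ffun 'I_a -> 'I_c} := [ffun j => t (s j)].
Definition idf n : {ffun 'I_n -> 'I_n} := [ffun j => j].
Definition const0 : {ffun 'I_1 -> 'I_2} := [ffun _ => ord0].

(* simplicial subsets of the thick simplex ΔΔ^n *)
Definition subcx n := forall m, pred {ffun 'I_m.+1 -> 'I_n.+1}.
Definition thick n : subcx n := fun m s => true.
Definition simp n : subcx n := fun m s => mono s.
Definition bdry n : subcx n :=
  fun m s => mono s && [exists j : 'I_n.+1, [forall l, s l != j]].
Definition horn n (i : 'I_n.+1) : subcx n :=
  fun m s => mono s && [exists j : 'I_n.+1, (j != i) && [forall l, s l != j]].
Arguments thick : clear implicits.
Arguments simp : clear implicits.
Arguments bdry : clear implicits.
Arguments horn : clear implicits.
Arguments horn {n} i.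

Record sdata (C : category) := SData {
  sob : nat -> C;
  (* action of t : [m'] -> [m] (meaningful for monotone t) *)
  smap : forall m m', {ffun 'I_m'.+1 -> 'I_m.+1} -> hom (sob m) (sob m') }.
Arguments sob {C} s n.
Arguments smap {C} s {m m'} t.

Unset Implicit Arguments.
Section Simp.
Variable C : category.

Definition is_simplicial (X : sdata C) : Prop :=
  (forall m, smap X (idf m.+1) = idm (sob X m)) /\
  (forall m m' m'' (t : {ffun 'I_m'.+1 -> 'I_m.+1}) (u : {ffun 'I_m''.+1 -> 'I_m'.+1}),
     mono t -> mono u -> smap X (fcomp t u) = compm (smap X u) (smap X t)).

Definition smor (X Y : sdata C) (f : forall n, hom (sob X n) (sob Y n)) : Prop :=
  forall m m' (t : {ffun 'I_m'.+1 -> 'I_m.+1}), mono t ->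
    compm (f m') (smap X t) = compm (smap Y t) (f m).

Definition fam (X : sdata C) n (A : C) :=
  forall m, {ffun 'I_m.+1 -> 'I_n.+1} -> hom A (sob X m).

(* g is a simplicial map S -> Hom(A, X) *)
Definition cone (X : sdata C) n (S : subcx n) (A : C) (g : fam X n A) : Prop :=
  forall m m' (s : {ffun 'I_m.+1 -> 'I_n.+1}) (t : {ffun 'I_m'.+1 -> 'I_m.+1}),
    S m s -> mono t -> g m' (fcomp s t) = compm (smap X t) (g m s).

(* Map(S, X): the limit representing simplicial maps S -> X *)
Record mapobj (X : sdata C) n (S : subcx n) := MapObj {
  mo : C;
  mu : fam X n mo;
  mu_cone : cone X n S _ mu;
  mlift : forall A, fam X n A -> hom A mo;
  mlift_spec : forall A (g : fam X n A), cone X n S A g ->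
    forall m s, S m s -> compm (mu m s) (mlift A g) = g m s;
  m_uniq : forall A (h h' : hom A mo),
    (forall m s, S m s -> compm (mu m s) h = compm (mu m s) h') -> h = h' }.

(* Map(S -> T, f) = Map(S,X) x_{Map(S,Y)} Map(T,Y) *)
Record relmap (X Y : sdata C) (f : forall n, hom (sob X n) (sob Y n)) n (S T : subcx n) :=
 RelMap {
  ro : C;
  ru : fam X n ro;
  rv : fam Y n ro;
  ru_cone : cone X n S _ ru;
  rv_cone : cone Y n T _ rv;
  r_compat : forall m s, S m s -> compm (f m) (ru m s) = rv m s;
  rlift : forall A, fam X n A -> fam Y n A -> hom A ro;
  rlift_spec : forall A (g : fam X n A) (g' : fam Y n A), cone X n S A g -> cone Y n T A g' ->
    (forall m s, S m s -> compm (f m) (g m s) = g' m s) ->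
    (forall m s, S m s -> compm (ru m s) (rlift A g g') = g m s) /\
    (forall m s, T m s -> compm (rv m s) (rlift A g g') = g' m s);
  r_uniq : forall A (h h' : hom A ro),
    (forall m s, S m s -> compm (ru m s) h = compm (ru m s) h') ->
    (forall m s, T m s -> compm (rv m s) h = compm (rv m s) h') -> h = h' }.

(* the canonical simplicial map Δ^n -> Hom(X_n, X) (Yoneda: X_n = Map(Δ^n,X)) *)
Definition canon (X : sdata C) n : fam X n (sob X n) := fun m s => smap X s.

Variable cov : morclass C.

Definition k_category (k : nat) (X : sdata C) : Prop :=
  is_simplicial X /\
  (forall n (i : 'I_n.+1), 0 < i < n -> forall M : mapobj X n (horn i),
     cov _ _ (mlift X n (horn i) M _ (canon X n)) /\ (k < n -> is_iso (mlift X n (horn i) M _ (canon X n)))) /\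
  (forall M : mapobj X 1 (thick 1), cov _ _ (mu X 1 (thick 1) M 0 const0)).

Definition regular_k_category (reg : morclass C) (k : nat) (X : sdata C) : Prop :=
  k_category k X /\ (forall M : mapobj X 1 (thick 1), reg _ _ (mu X 1 (thick 1) M 1 (idf 2))).

Definition k_groupoid (k : nat) (X : sdata C) : Prop :=
  is_simplicial X /\
  (forall n (i : 'I_n.+1), 0 < n -> forall M : mapobj X n (horn i),
     cov _ _ (mlift X n (horn i) M _ (canon X n)) /\ (k < n -> is_iso (mlift X n (horn i) M _ (canon X n)))).

Definition hypercover (X Y : sdata C) (f : forall n, hom (sob X n) (sob Y n)) : Prop :=
  forall n (P : relmap X Y f n (bdry n) (simp n)),
    cov _ _ (rlift X Y f n (bdry n) (simp n) P _ (canon X n) (fun m s => compm (smap Y s) (f n))).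

Definition GG (X : sdata C) (Mp : forall n, mapobj X n (thick n)) : sdata C :=
  @SData C (fun n => mo X n (thick n) (Mp n))
        (fun n m t => mlift X m (thick m) (Mp m) _ (fun l s => mu X n (thick n) (Mp n) l (fcomp t s))).

End Simp.
Arguments mo {C X n S} _.
Arguments mu {C X n S} _ {m} s.
Arguments mlift {C X n S} _ {A} g.
Arguments rlift {C X Y f n S T} _ {A} g g'.
Arguments is_simplicial {C} X.
Arguments smor {C} X Y f.
Arguments cone {C X n} S {A} g.
Arguments canon {C} X n.
Arguments k_category {C} cov k X.
Arguments regular_k_category {C} cov reg k X.
Arguments k_groupoid {C} cov k X.
Arguments hypercover {C} cov X Y f.
Arguments GG {C X} Mp.
Arguments mapobj {C} X n S.
Arguments relmap {C} X Y f n S T.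
Arguments fam {C} X n A.

(* Main.v *)
From mathcomp Require Import boolp zify.
Require Import Defs.
From mathcomp Require Import all_boot.
Set Implicit Arguments. Unset Strict Implicit. Unset Printing Implicit Defensive.

(* Call an inclusion S < T of simplicial sets good if Map(T,X) -> Map(S,X) is representable by
   covers. Attaching an inner horn is good, so S < T is good as soon as the nondegenerate simplices
   of T outside S can be matched in pairs (w, an inner face of w) acyclically. The simplices of the
   thick simplex are the words in the letters 0, .., n. For n >= 2 explicit matchings, which insert
   or delete a letter at a prescribed inner place, show that the inclusions into the thick simplex of
   (1) its thick horns and (2) the union of its thick boundary with Delta^n are good; (1) uses only
   horns of dimension at least n, so it even gives isomorphisms for n > k.
   By (1), GG(X) is a k-groupoid. As G(X)_n -> X_n is monic, (2) is the hypercover condition on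
   GG(X) -> G(X) for n >= 2, while for n <= 1 it amounts to GG(X)_n -> G(X)_n being a cover.
   A horn of G(X) then lifts locally along the hypercover, is filled in GG(X), and the filler is
   pushed down to G(X). *)

(** Two obstacles shape the argument. The thick simplex has nondegenerate simplices in every
    dimension, so the matchings are infinite, while covers compose only finitely often. The finitely
    many cells of dimension at most [k] therefore give covers, and all later cells give
    isomorphisms, which survive passage to the union of the chain. Moreover, subcomplexes of the
    thick simplex are not finite, so their mapping spaces are not finite limits at hand; goodness is
    stated for families over a test object instead. The bound n >= 2 comes from the matchings. As
    [X] fills inner horns only, a letter must be inserted with something on either side of it. The
    place is mostly found by scanning a word up to the second letter different from a distinguished
    one, so two further letters must exist. In dimension 1 the input is that evaluation of the thick
    edge at a vertex is a cover. Regularity enters through the coimages: it makes GG(X)_n -> G(X)_n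
    a cover and G(X)_n -> X_n monic. *)

Local Notation "g \c f" := (compm g f) (at level 40, left associativity).

(** * Covers, epimorphisms and images in a descent category *)

Section Categories.
Variable C : category.

Definition monic (a b : C) (f : hom a b) : Prop :=
  forall (x : C) (u v : hom x a), f \c u = f \c v -> u = v.

Definition epic (a b : C) (f : hom a b) : Prop :=
  forall (x : C) (u v : hom b x), u \c f = v \c f -> u = v.

(** Attaching cells is treated for all such classes at once and applied to three: covers,
    isomorphisms, and all morphisms, where a statement reduces to the existence of a limit. *)
Definition stable_class (W : morclass C) : Prop :=
  [/\ forall a b (f : hom a b), is_iso f -> W _ _ f,
      forall a b c (g : hom b c) (f : hom a b), W _ _ f -> W _ _ g -> W _ _ (g \c f)
    & pullback_stable W].

Lemma iso_id (a : C) : is_iso (idm a).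
Proof. by exists (idm a); rewrite comp_idl. Qed.

Lemma stable_iso : stable_class (@is_iso C).
Proof.
split=> // [a b c g f [f' [ff' f'f]] [g' [gg' g'g]]|a b c P f g p1 p2 [f' [f'f ff']] [sq univ]].
  exists (f' \c g'); split.
    by rewrite -comp_assoc (comp_assoc g') gg' comp_idl.
  by rewrite -comp_assoc (comp_assoc f) f'f comp_idl.
have [|h [[h1 h2] _]] := univ b (f' \c g) (idm b).
  by rewrite comp_assoc ff' comp_idl comp_idr.
exists h; split=> //.
have [k [_ uk]] := univ P p1 p2 sq.
rewrite -(uk (idm P)) ?comp_idr //; apply: esym; apply: uk; split.
  by rewrite comp_assoc h1 -comp_assoc -sq comp_assoc f'f comp_idl.
by rewrite comp_assoc h2 comp_idl.
Qed.

Lemma iso_pullback_id (a b : C) (u : hom a b) :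
  is_iso u -> is_pullback (idm b) (idm b) u u.
Proof.
move=> [v [vu uv]]; split=> // Q q1 q2; rewrite !comp_idl => <-.
exists (v \c q1); split; first by rewrite comp_assoc uv comp_idl.
by move=> h [<- _]; rewrite comp_assoc vu comp_idl.
Qed.

Lemma coequalizer_epic (k x z : C) (u v : hom k x) (p : hom x z) :
  is_coequalizer u v p -> epic p.
Proof.
move=> [pe univ] y a b ab.
have [|r [_ ur]] := univ y (a \c p); first by rewrite -!comp_assoc pe.
by rewrite -(ur a) // -(ur b).
Qed.

Lemma coimage_epic (x y z : C) (f : hom x y) (p : hom x z) : is_coimage f p -> epic p.
Proof. by move=> [k [u [v [_ /coequalizer_epic]]]]. Qed.

Lemma coimage_factor (x y z t : C) (f : hom x y) (p : hom x z) (q : hom x t) :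
  is_coimage f p ->
  (forall k (u v : hom k x), f \c u = f \c v -> q \c u = q \c v) ->
  exists r : hom z t, r \c p = q.
Proof.
move=> [k [u [v [[sq _] [_ univ]]]]] /(_ _ _ _ sq) /univ [r [rq _]].
by exists r.
Qed.

Lemma coimage_eq (x y z : C) (f : hom x y) (p : hom x z) :
  is_coimage f p ->
  forall k (u v : hom k x), f \c u = f \c v -> p \c u = p \c v.
Proof.
move=> [k [u [v [[sq univ] [pe _]]]]] k' u' v' /univ [h [[<- <-] _]].
by rewrite !comp_assoc pe.
Qed.

Section Descent.
Variable cov : morclass C.
Hypotheses (Hd : descent_category cov) (Hs : subcanonical cov).

Lemma has_pullbacks (a b c : C) (f : hom a c) (g : hom b c) :
  exists (P : C) (p1 : hom P a) (p2 : hom P b), is_pullback f g p1 p2.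
Proof. by case: Hd => -[_ pb] _; apply: pb. Qed.

Lemma stable_cov : stable_class cov.
Proof.
case: Hd => _ [[cid cc] [cpb _]]; split=> // a b u /iso_pullback_id; exact: cpb.
Qed.

Lemma cov_cancel (a b c : C) (f : hom a b) (g : hom b c) :
  cov f -> cov (g \c f) -> cov g.
Proof. by case: Hd => _ [_ [_ cl]]; apply: cl. Qed.

Lemma cov_epic (a b : C) (f : hom a b) : cov f -> epic f.
Proof.
move=> /Hs [z [p [i [/coimage_epic ep [<- [j [ji ij]]]]]]] x u v.
rewrite !comp_assoc => /ep uv.
by rewrite -(comp_idr u) -(comp_idr v) -ij !comp_assoc uv.
Qed.

(** Up to an isomorphism a cover is its own coimage. As [j] is monic, [q] identifies whatever
    [j \c q] does, so it descends to that coimage and yields a section of [j]; a monic with a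
    section is an isomorphism. *)
Lemma cov_through_monic (a b c : C) (q : hom a b) (j : hom b c) :
  monic j -> cov (j \c q) -> is_iso j.
Proof.
move=> mj /Hs [z [p [i [ci [ip [i' [i'i ii']]]]]]].
have [k u v|r rp] := coimage_factor (q := q) ci.
  by rewrite -!comp_assoc => /mj.
have jr : j \c r = i.
  by apply: (coimage_epic ci); rewrite ip -comp_assoc rp.
exists (r \c i'); have jri : j \c (r \c i') = idm c by rewrite comp_assoc jr ii'.
by split=> //; apply: mj; rewrite comp_assoc jri comp_idl comp_idr.
Qed.

Lemma cov_monic_iso (a b : C) (f : hom a b) : cov f -> monic f -> is_iso f.
Proof. by move=> cf mf; apply: (cov_through_monic (q := idm a)) => //; rewrite comp_idr. Qed.

(** This settles the dimensions at most 1, where the target of a comparison map embeds into a space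
    onto which the source maps by a cover. *)
Lemma cov_through_monic_fst (a b c : C) (q : hom a b) (j : hom b c) :
  monic j -> cov (j \c q) -> cov q.
Proof.
move=> mj cjq; have [r [rj jr]] := cov_through_monic mj cjq.
have [ci cc _] := stable_cov.
have -> : q = r \c (j \c q) by rewrite comp_assoc rj comp_idl.
by apply: cc => //; apply: ci; exists j.
Qed.

Lemma cov_local_lift (a b : C) (f : hom a b) (x : C) (u : hom x b) :
  cov f -> exists (z : C) (c : hom z x) (l : hom z a), cov c /\ f \c l = u \c c.
Proof.
move=> cf; have [P [p1 [p2 pb]]] := has_pullbacks f u.
exists P, p2, p1; split; last by case: pb.
by have [_ _ st] := stable_cov; apply: st pb.
Qed.

Lemma coimage_cov (x y z z' : C) (f : hom x y) (p : hom x z) (p' : hom x z') :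
  is_coimage f p -> is_coimage f p' -> cov p' -> cov p.
Proof.
move=> cp cp' covp.
have [r rp] := coimage_factor cp' (coimage_eq cp).
have [r' rp'] := coimage_factor cp (coimage_eq cp').
have [ci cc _] := stable_cov.
rewrite -rp; apply: cc => //; apply: ci; exists r'; split.
  by apply: (coimage_epic cp'); rewrite -comp_assoc rp rp' comp_idl.
by apply: (coimage_epic cp); rewrite -comp_assoc rp' rp comp_idl.
Qed.

(** Two maps identified by [i] lift along [p] after passing to a common cover. The lifts agree under
    [f], hence under [p], and covers are epic. *)
Lemma coimage_image_monic (x y z : C) (f : hom x y) (p : hom x z) (i : hom z y) :
  is_coimage f p -> i \c p = f -> cov p -> monic i.
Proof.
move=> cp ip covp w a b iab.
have [w1 [c1 [l1 [cc1 e1]]]] := cov_local_lift a covp.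
have [w2 [c2 [l2 [cc2 e2]]]] := cov_local_lift (b \c c1) covp.
apply: (cov_epic cc1); apply: (cov_epic cc2).
rewrite -e1 -e2 -comp_assoc; apply: (coimage_eq cp).
by rewrite -ip -!comp_assoc e2 !comp_assoc -(comp_assoc i) e1 comp_assoc iab.
Qed.

End Descent.
End Categories.

(** * Maps between finite ordinals *)

Lemma monoP a b (t : {ffun 'I_a -> 'I_b}) :
  reflect (forall x y : 'I_a, x <= y -> t x <= t y) (mono t).
Proof.
apply: (iffP forallP) => [H x y xy|H x]; last by apply/forallP=> y; apply/implyP/H.
by move/forallP: (H x) => /(_ y) /implyP; apply.
Qed.

Lemma fcompE a b c (t : {ffun 'I_b -> 'I_c}) (s : {ffun 'I_a -> 'I_b}) x :
  fcomp t s x = t (s x).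
Proof. by rewrite ffunE. Qed.

Lemma fcompA a b c d (r : {ffun 'I_c -> 'I_d}) (t : {ffun 'I_b -> 'I_c})
  (s : {ffun 'I_a -> 'I_b}) : fcomp (fcomp r t) s = fcomp r (fcomp t s).
Proof. by apply/ffunP=> x; rewrite !fcompE. Qed.

Lemma fcomp_idl a b (s : {ffun 'I_a -> 'I_b}) : fcomp (idf b) s = s.
Proof. by apply/ffunP=> x; rewrite !ffunE. Qed.

Lemma fcomp_idr a b (s : {ffun 'I_a -> 'I_b}) : fcomp s (idf a) = s.
Proof. by apply/ffunP=> x; rewrite !ffunE. Qed.

Lemma mono_idf n : mono (idf n).
Proof. by apply/monoP=> x y xy; rewrite !ffunE. Qed.

Lemma mono_fcomp a b c (t : {ffun 'I_b -> 'I_c}) (s : {ffun 'I_a -> 'I_b}) :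
  mono t -> mono s -> mono (fcomp t s).
Proof. by move=> /monoP mt /monoP ms; apply/monoP=> x y /ms /mt; rewrite !fcompE. Qed.

Lemma mono_cst a b (y : 'I_b) : mono ([ffun _ => y] : {ffun 'I_a -> 'I_b}).
Proof. by apply/monoP=> *; rewrite !ffunE. Qed.

Lemma mono_factor a b c (t : {ffun 'I_a.+1 -> 'I_b}) (u : {ffun 'I_c -> 'I_b}) :
  mono t -> mono u -> (forall y, exists x, t x = u y) ->
  exists e, mono e /\ fcomp t e = u.
Proof.
move=> /monoP mt /monoP mu im.
(* Preimages are chosen as a function of [u y] alone, so equal values get equal preimages; this
   makes [e] monotone. The default [ord0] is never reached. *)
pose e : {ffun 'I_c -> 'I_a.+1} := [ffun y => odflt ord0 [pick x | t x == u y]].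
have te y : t (e y) = u y.
  rewrite ffunE; case: pickP => [x /eqP //|no].
  by have [x xy] := im y; move: (no x); rewrite xy eqxx.
exists e; split; last by apply/ffunP=> y; rewrite fcompE.
apply/monoP=> x y xy; have := mu _ _ xy; rewrite leq_eqVlt => /orP[/eqP/val_inj uxy|].
  by rewrite !ffunE uxy.
by rewrite -!te; apply: contraTT; rewrite -!ltnNge ltnS => /ltnW /mt.
Qed.

Lemma mono_inj_bounds a b (t : {ffun 'I_a.+1 -> 'I_b.+1}) (x : 'I_a.+1) :
  mono t -> injective t -> x <= t x /\ t x + (a - x) <= b.
Proof.
move=> /monoP mt ti.
have st (y z : 'I_a.+1) : y < z -> t y < t z.
  move=> yz; rewrite ltn_neqAle mt ?(ltnW yz) // andbT.
  by apply: contraTneq yz => /val_inj/ti ->; rewrite ltnn.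
split.
  case: x => x /= xa; elim: x xa => // x IH xa.
  by have /st := ltnSn x : Ordinal (ltnW xa) < Ordinal xa; apply: leq_ltn_trans (IH _).
have : forall k (y : 'I_a.+1), a - y = k -> t y + k <= b; last exact.
elim=> [|k IH] y ayk; first by rewrite addn0 -ltnS.
have ya : y.+1 < a.+1 by lia.
have /st tyy := ltnSn y : y < Ordinal ya.
have := IH (Ordinal ya); rewrite /=; lia.
Qed.

Lemma mono_inj_id a (t : {ffun 'I_a.+1 -> 'I_a.+1}) :
  mono t -> injective t -> t = idf _.
Proof.
move=> mt ti; apply/ffunP=> x; rewrite ffunE; apply/val_inj=> /=.
have := mono_inj_bounds x mt ti; have := ltn_ord x; lia.
Qed.

Definition coface m (j : 'I_m.+2) : {ffun 'I_m.+1 -> 'I_m.+2} := [ffun x => lift j x].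

Lemma coface_mono m (j : 'I_m.+2) : mono (coface j).
Proof. by apply/monoP=> x y xy; rewrite !ffunE /= /bump; lia. Qed.

Lemma coface_inj m (j : 'I_m.+2) : injective (coface j).
Proof. by move=> x y; rewrite !ffunE => /lift_inj. Qed.

Lemma coface_neq m (j : 'I_m.+2) x : coface j x != j.
Proof. by rewrite ffunE eq_sym neq_lift. Qed.

Lemma coface_onto m (j y : 'I_m.+2) : y != j -> exists x, coface j x = y.
Proof.
rewrite eq_sym => yj; have [x -> _] := unlift_some yj.
by exists x; rewrite ffunE.
Qed.

Lemma mono_skip a m (j : 'I_m.+2) (t : {ffun 'I_a -> 'I_m.+2}) :
  mono t -> (forall x, t x != j) -> exists e, mono e /\ t = fcomp (coface j) e.
Proof.
move=> mt tj; have [y|e [me <-]] := mono_factor (coface_mono j) mt.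
  by apply: coface_onto.
by exists e.
Qed.

Lemma mono_inj_coface m (t : {ffun 'I_m.+1 -> 'I_m.+2}) :
  mono t -> injective t -> exists j, t = coface j.
Proof.
move=> mt ti.
have [j tj] : exists j, forall x, t x != j.
  apply: contrapT => no.
  have surj j : j \in codom t.
    apply: contrapT => nj; apply: no; exists j => x.
    by apply/eqP=> e; apply: nj; rewrite -e codom_f.
  have := card_codom ti; rewrite !card_ord; suff -> : #|codom t| = m.+2 by lia.
  by rewrite -[RHS]card_ord; apply/eq_card=> j; rewrite surj.
have [e [me te]] := mono_skip mt tj; exists j.
suff -> : t = fcomp (coface j) (idf _) by rewrite fcomp_idr.
rewrite te (mono_inj_id me) // => x y exy.
by apply: ti; rewrite te !fcompE exy.
Qed.

(** * Nondegenerate simplices of the thick simplex *)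

Definition nondegenerate m n (w : {ffun 'I_m.+1 -> 'I_n.+1}) : Prop :=
  forall x y : 'I_m.+1, y = x.+1 :> nat -> w x != w y.

(** The Eilenberg-Zilber factorization, merging one pair of equal neighbours at a time. The map [e]
    is recorded because it places [w] in every subcomplex that contains [s]. *)
Lemma nondegenerate_factor m n (s : {ffun 'I_m.+1 -> 'I_n.+1}) :
  exists d (w : {ffun 'I_d.+1 -> 'I_n.+1}) (t : {ffun 'I_m.+1 -> 'I_d.+1})
    (e : {ffun 'I_d.+1 -> 'I_m.+1}),
  [/\ nondegenerate w, mono t, mono e, s = fcomp w t & w = fcomp s e] /\ d <= m.
Proof.
elim: m s => [|m IH] s.
  exists 0, s, (idf _), (idf _); split=> //; split; rewrite ?fcomp_idr ?mono_idf //.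
  by move=> x y; rewrite (ord1 x) (ord1 y).
case: (pselect (nondegenerate s)) => [nd|deg].
  by exists m.+1, s, (idf _), (idf _); split=> //; split; rewrite ?fcomp_idr ?mono_idf.
have [x [y [yx /eqP sxy]]] : exists x y : 'I_m.+2, y = x.+1 :> nat /\ s x == s y.
  apply: contrapT => no; apply: deg => x y yx.
  by apply/negP=> sxy; apply: no; exists x, y.
have [d [w [t [e [[nw mt me sw ws] dm]]]]] := IH (fcomp s (coface y)).
pose sg : {ffun 'I_m.+2 -> 'I_m.+1} := [ffun z : 'I_m.+2 => inord (if z <= x then z : nat else z.-1)].
have sgE (z : 'I_m.+2) : sg z = (if z <= x then z : nat else z.-1) :> nat.
  by rewrite ffunE inordK //; have := ltn_ord z; have := ltn_ord y; case: ifP; lia.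
exists d, w, (fcomp t sg), (fcomp (coface y) e); split; last exact: leqW.
have msg : mono sg by apply/monoP=> u v uv; rewrite !sgE; case: ifP; case: ifP; lia.
split=> //; rewrite ?mono_fcomp ?coface_mono //; last by rewrite -fcompA.
rewrite -fcompA -sw; apply/ffunP=> z; rewrite !fcompE ffunE.
have [->|zy] := eqVneq z y.
  rewrite -sxy; congr (s _); apply/val_inj=> /=; rewrite sgE /bump; case: ifP; lia.
congr (s _); apply/val_inj=> /=; move: zy; rewrite -val_eqE /= sgE /bump; case: ifP; lia.
Qed.

Lemma mono_nondegenerate_inj m n (w : {ffun 'I_m.+1 -> 'I_n.+1}) :
  mono w -> nondegenerate w -> injective w.
Proof.
move=> /monoP mw nw.
have st (x y : 'I_m.+1) : x < y -> w x != w y.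
  move=> xy; have xm : x.+1 < m.+1 by have := ltn_ord y; lia.
  apply: contraNneq (nw x (Ordinal xm) erefl) => wxy.
  by rewrite -val_eqE eqn_leq mw //= wxy mw.
by move=> x y wxy; case: (ltngtP x y) => [/st|/st|/val_inj //]; rewrite wxy eqxx.
Qed.

Lemma inj_nondegenerate m n (w : {ffun 'I_m.+1 -> 'I_n.+1}) :
  injective w -> nondegenerate w.
Proof. by move=> wi x y yx; apply: contraTneq isT => /wi xy; move: yx; rewrite xy; lia. Qed.

Lemma nondegenerate_comp_inj m d n (w : {ffun 'I_d.+1 -> 'I_n.+1})
  (t : {ffun 'I_m.+1 -> 'I_d.+1}) :
  mono t -> nondegenerate (fcomp w t) -> injective t.
Proof.
move=> mt nwt; apply: mono_nondegenerate_inj => // x y yx.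
by have := nwt x y yx; rewrite !fcompE; apply: contraNneq => ->.
Qed.

(** A letter goes to the largest letter of [s] not above it, or to the smallest letter of [s] if
    there is none, whence the bound [maxn y (s x0)]. Such an [r] names the ordered face spanned by
    the letters of [s] without a choice of its dimension. *)
Lemma mono_retraction m n (s : {ffun 'I_m.+1 -> 'I_n.+1}) :
  exists r : {ffun 'I_n.+1 -> 'I_n.+1},
    [/\ mono r, fcomp r s = s & forall y, exists x, r y = s x].
Proof.
pose x0 := [arg min_(x < (ord0 : 'I_m.+1)) s x].
have x0P x : s x0 <= s x by rewrite /x0; case: arg_minnP => // z _; apply.
pose b y := [arg max_(x > x0 | s x <= maxn y (s x0)) s x].
have bP y : s (b y) <= maxn y (s x0) /\ forall x, s x <= maxn y (s x0) -> s x <= s (b y).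
  by rewrite /b; case: arg_maxnP => // ; rewrite leq_maxr.
exists [ffun y : 'I_n.+1 => s (b y)]; split.
- apply/monoP=> y z yz; rewrite !ffunE; apply: (bP z).2.
  by apply: leq_trans (bP y).1 _; rewrite geq_max !leq_max leqnn yz orbT.
- apply/ffunP=> x; rewrite fcompE ffunE; apply/val_inj/eqP => /=; rewrite eqn_leq.
  have mx : maxn (s x) (s x0) = s x by apply/maxn_idPl/x0P.
  have [] := bP (s x); rewrite mx => -> H; exact: H.
- by move=> y; exists (b y); rewrite ffunE.
Qed.

(** * Simplicial subsets and representable restriction maps *)

Definition subcx_le n (S T : subcx n) : Prop := forall m s, S m s -> T m s.
Definition subcx_eq n (S T : subcx n) : Prop := forall m s, S m s = T m s.
Definition face_closed n (S : subcx n) : Prop :=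
  forall m m' s (t : {ffun 'I_m'.+1 -> 'I_m.+1}), S m s -> mono t -> S m' (fcomp s t).

Definition cell n m (w : {ffun 'I_m.+1 -> 'I_n.+1}) : subcx n :=
  fun q s => [exists t : {ffun 'I_q.+1 -> 'I_m.+1}, mono t && (s == fcomp w t)].
Definition add_cell n (S : subcx n) m (w : {ffun 'I_m.+1 -> 'I_n.+1}) : subcx n :=
  fun q s => S q s || cell w s.

Lemma cellP n m (w : {ffun 'I_m.+1 -> 'I_n.+1}) q (s : {ffun 'I_q.+1 -> 'I_n.+1}) :
  reflect (exists t, mono t /\ s = fcomp w t) (cell w s).
Proof.
apply: (iffP existsP) => [[t /andP[mt /eqP ->]]|[t [mt ->]]]; exists t => //.
by rewrite mt eqxx.
Qed.

Lemma cell_closed n m (w : {ffun 'I_m.+1 -> 'I_n.+1}) : face_closed (cell w).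
Proof.
move=> q q' s t /cellP[u [mu ->]] mt; apply/cellP; exists (fcomp u t).
by rewrite fcompA mono_fcomp.
Qed.

Lemma cell_self n m (w : {ffun 'I_m.+1 -> 'I_n.+1}) : cell w w.
Proof. by apply/cellP; exists (idf _); rewrite fcomp_idr mono_idf. Qed.

Lemma simp_closed n : face_closed (simp n).
Proof. by move=> m m' s t; apply: mono_fcomp. Qed.

Section Rel.
Variable C : category.
Implicit Types X Y : sdata C.

Definition simp_map X Y := forall n, hom (sob X n) (sob Y n).

(* Map(T,X) -> Map(S -> T, f) is representable by maps in [W]; this is phrased on
   generalized points, so that none of the mapping spaces has to exist. *)
Definition relrep (W : morclass C) X Y (f : simp_map X Y) n (S T : subcx n) : Prop :=
  forall (A : C) (g : fam X n A) (h : fam Y n A), cone S g -> cone T h ->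
    (forall m s, S m s -> f m \c g m s = h m s) ->
  exists (P : C) (c : hom P A) (g' : fam X n P),
    [/\ W _ _ c, cone T g',
        (forall m s, S m s -> g' m s = g m s \c c),
        (forall m s, T m s -> f m \c g' m s = h m s \c c)
      & (forall (B : C) (b : hom B A) (k : fam X n B), cone T k ->
           (forall m s, S m s -> k m s = g m s \c b) ->
           (forall m s, T m s -> f m \c k m s = h m s \c b) ->
           exists u : hom B P, c \c u = b /\ forall m s, T m s -> g' m s \c u = k m s) /\
        (forall (B : C) (u v : hom B P), c \c u = c \c v ->
           (forall m s, T m s -> g' m s \c u = g' m s \c v) -> u = v)].

(** The form that [relrep] takes for [K] inside the ordinary simplex: by Yoneda, families on that
    simplex become single maps into [X] and [Y]. *)
Definition cell_rel (W : morclass C) X Y (f : simp_map X Y) m (K : subcx m) : Prop :=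
  forall (A : C) (g : fam X m A) (y : hom A (sob Y m)), cone K g ->
    (forall q t, K q t -> f q \c g q t = smap Y t \c y) ->
  exists (P : C) (c : hom P A) (x : hom P (sob X m)),
    [/\ W _ _ c, (forall q t, K q t -> smap X t \c x = g q t \c c), f m \c x = y \c c,
        (forall (B : C) (b : hom B A) (z : hom B (sob X m)),
           (forall q t, K q t -> smap X t \c z = g q t \c b) -> f m \c z = y \c b ->
           exists u : hom B P, c \c u = b /\ x \c u = z)
      & (forall (B : C) (u v : hom B P), c \c u = c \c v -> x \c u = x \c v -> u = v)].

Lemma cone_le X n (S T : subcx n) A (g : fam X n A) : subcx_le S T -> cone T g -> cone S g.
Proof. by move=> ST cg m m' s t /ST /cg; apply. Qed.

Definition fcompm X n A B (g : fam X n A) (b : hom B A) : fam X n B := fun m s => g m s \c b.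

Lemma cone_comp X n (S : subcx n) A B (g : fam X n A) (b : hom B A) :
  cone S g -> cone S (fcompm g b).
Proof. by move=> cg m m' s t Ss mt; rewrite /fcompm (cg _ _ _ _ Ss mt) comp_assoc. Qed.

Lemma cone_canon X n : is_simplicial X -> cone (simp n) (canon X n).
Proof. by move=> [_ sc] m m' s t Ss mt; rewrite /canon sc. Qed.

Lemma cone_pullback X n (S : subcx n) m (K : subcx m)
  (w : {ffun 'I_m.+1 -> 'I_n.+1}) A (g : fam X n A) :
  cone S g -> (forall q t, K q t -> S q (fcomp w t)) ->
  cone K ((fun q t => g q (fcomp w t)) : fam X m A).
Proof. by move=> cg KS q q' t t' /KS Ss mt'; rewrite -fcompA cg. Qed.

Section Class.
Variable W : morclass C.
Hypothesis HW : stable_class W.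

Lemma rel_eq X Y (f : simp_map X Y) n (S S' T T' : subcx n) :
  subcx_eq S S' -> subcx_eq T T' -> relrep W f S T -> relrep W f S' T'.
Proof.
move=> SS' TT' R A g h cg ch fgh.
have sS : subcx_le S S' by move=> m s; rewrite SS'.
have sS' : subcx_le S' S by move=> m s; rewrite SS'.
have sT : subcx_le T T' by move=> m s; rewrite TT'.
have sT' : subcx_le T' T by move=> m s; rewrite TT'.
have [||m s /sS /fgh //|P [c [g' [Wc cg' e1 e2 [ex un]]]]] := R A g h.
- exact: cone_le cg.
- exact: cone_le ch.
exists P, c, g'; split=> //; first exact: cone_le cg'.
- by move=> m s /sS' /e1.
- by move=> m s /sT' /e2.
split=> [B b k ck k1 k2|B u v cuv guv].
  have [||m s /sT /k2 //|u [cu gu]] := ex B b k.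
  - exact: cone_le ck.
  - by move=> m s /sS /k1.
  by exists u; split=> // m s /sT' /gu.
by apply: un => // m s /sT; apply: guv.
Qed.

Lemma rel_refl X Y (f : simp_map X Y) n (S : subcx n) : relrep W f S S.
Proof.
have [Wi _ _] := HW; move=> A g h cg ch fgh; exists A, (idm A), g; split=> //.
- by apply: Wi; apply: iso_id.
- by move=> m s _; rewrite comp_idr.
- by move=> m s Ss; rewrite comp_idr fgh.
split=> [B b k ck k1 k2|B u v]; last by rewrite !comp_idl.
by exists b; rewrite comp_idl; split=> // m s /k1.
Qed.

Lemma rel_trans X Y (f : simp_map X Y) n (S T U : subcx n) :
  subcx_le S T -> subcx_le T U -> relrep W f S T -> relrep W f T U -> relrep W f S U.
Proof.
have [_ Wc _] := HW; move=> ST TU R1 R2 A g h cg ch fgh.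
have [//||//|P [c [g1 [Wc1 cg1 e1 f1 [ex1 un1]]]]] := R1 A g h; first exact: cone_le ch.
have [//||//|Q [d [g2 [Wc2 cg2 e2 f2 [ex2 un2]]]]] := R2 P g1 (fcompm h c).
  exact: cone_comp.
exists Q, (c \c d), g2; split=> //.
- exact: Wc.
- by move=> m s Ss; rewrite e2 ?e1 ?comp_assoc //; apply: ST.
- by move=> m s Us; rewrite f2 // /fcompm comp_assoc.
split=> [B b k ck k1 k2|B u v cuv guv].
  have [|//|m s /TU /k2 //|u [cu gu]] := ex1 B b k; first exact: cone_le ck.
  have [m s /gu //|m s Us|v [cv gv]] := ex2 B u k ck.
    by rewrite k2 // /fcompm -comp_assoc cu.
  by exists v; rewrite -comp_assoc cv.
have duv : d \c u = d \c v.
  apply: un1; first by rewrite !comp_assoc.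
  by move=> m s Ts; rewrite !comp_assoc -!e2 // guv //; apply: TU.
exact: un2.
Qed.

Section Glue.
Variables (X : sdata C) (n : nat) (T : subcx n) (m : nat) (w : {ffun 'I_m.+1 -> 'I_n.+1}).
Hypothesis HX : is_simplicial X.
Hypothesis Tcl : face_closed T.
Hypothesis Tw : forall q (t t' : {ffun 'I_q.+1 -> 'I_m.+1}), mono t -> mono t' ->
  ~~ T (fcomp w t) -> fcomp w t = fcomp w t' -> t = t'.
Variables (A : C) (g : fam X n A) (x : hom A (sob X m)).
Hypothesis cg : cone T g.
Hypothesis gx : forall q (t : {ffun 'I_q.+1 -> 'I_m.+1}), mono t -> T (fcomp w t) ->
  smap X t \c x = g (fcomp w t).

(** Outside [T] the map [t] is unique by [Tw], and inside [T] the two prescriptions agree by [gx].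
    The last branch is a default value off [add_cell T w]. *)
Definition glue : fam X n A := fun q s =>
  if T s then g s
  else if [pick t : {ffun 'I_q.+1 -> 'I_m.+1} | mono t && (s == fcomp w t)] is Some t
       then smap X t \c x else g s.

Lemma glueT q (s : {ffun 'I_q.+1 -> 'I_n.+1}) : T s -> glue s = g s.
Proof. by rewrite /glue => ->. Qed.

Lemma glue_cell q (t : {ffun 'I_q.+1 -> 'I_m.+1}) : mono t -> glue (fcomp w t) = smap X t \c x.
Proof.
move=> mt; rewrite /glue; case: ifPn => [Tt|nT]; first by rewrite gx.
case: pickP => [t' /andP[mt' /eqP e]|/(_ t)]; last by rewrite mt eqxx.
by rewrite (Tw _ _ _ e).
Qed.

Lemma glue_cone : cone (add_cell T w) glue.
Proof.
move=> q q' s t /orP[Ts|/cellP[u [mu ->]]] mt.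
  by rewrite !glueT ?cg //; apply: Tcl.
by rewrite fcompA !glue_cell ?mono_fcomp // HX.2 // comp_assoc.
Qed.

End Glue.

(** [K] is the preimage of [T] under [w], and [w] is injective off [K]; so [add_cell T w] is the
    pushout of [T] and the ordinary simplex along [K]. Injectivity of [w] everywhere would be too
    much to ask, since words repeat letters. *)
Lemma rel_add_cell X Y (f : simp_map X Y) n (T : subcx n) m (K : subcx m)
  (w : {ffun 'I_m.+1 -> 'I_n.+1}) :
  is_simplicial X -> is_simplicial Y -> smor X Y f ->
  face_closed T -> subcx_le K (simp m) ->
  (forall q (t : {ffun 'I_q.+1 -> 'I_m.+1}), mono t -> K q t = T q (fcomp w t)) ->
  (forall q (t t' : {ffun 'I_q.+1 -> 'I_m.+1}), mono t -> mono t' ->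
     ~~ T q (fcomp w t) -> fcomp w t = fcomp w t' -> t = t') ->
  cell_rel W f K -> relrep W f T (add_cell T w).
Proof.
move=> HX HY Hf Tcl Ksimp KT Tw R A g h cg ch fgh.
have hw q (t : {ffun 'I_q.+1 -> 'I_m.+1}) : mono t -> h q (fcomp w t) = smap Y t \c h m w.
  by apply: ch; rewrite /add_cell cell_self orbT.
have TK q (t : {ffun 'I_q.+1 -> 'I_m.+1}) : K q t -> T q (fcomp w t).
  by move=> Kt; rewrite -KT //; apply: Ksimp.
have [||P [c [x [Wc e1 e2 ex un]]]] := R A (fun q t => g q (fcomp w t)) (h m w).
- by apply: (cone_pullback cg).
- by move=> q t Kt; rewrite fgh ?hw //; [apply: Ksimp|apply: TK].
have gx q (t : {ffun 'I_q.+1 -> 'I_m.+1}) : mono t -> T q (fcomp w t) ->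
    smap X t \c x = fcompm g c (fcomp w t).
  by move=> mt; rewrite -KT // => /e1 ->.
have cgc : cone T (fcompm g c) by apply: cone_comp.
have [[gT gc] gcone] :=
  (@glueT X n T m w P (fcompm g c) x, glue_cell Tw gx, glue_cone HX Tcl Tw cgc gx).
exists P, c, (glue T w (fcompm g c) x); split=> //.
- move=> q s /orP[Ts|/cellP[t [mt ->]]]; first by rewrite gT // comp_assoc fgh.
  by rewrite gc // hw // comp_assoc Hf // -comp_assoc e2 comp_assoc.
split=> [B b k ck k1 k2|B u v cuv guv].
  have kw q (t : {ffun 'I_q.+1 -> 'I_m.+1}) : mono t -> k q (fcomp w t) = smap X t \c k m w.
    by apply: ck; rewrite /add_cell cell_self orbT.
  have [q t Kt||u [cu xu]] := ex B b (k m w).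
  - by rewrite -kw ?k1 //; [apply: TK|apply: Ksimp].
  - by rewrite k2 // /add_cell cell_self orbT.
  exists u; split=> // q s /orP[Ts|/cellP[t [mt ->]]].
    by rewrite gT // k1 // /fcompm -comp_assoc cu.
  by rewrite gc // -comp_assoc xu kw.
have gw : glue T w (fcompm g c) x w = x.
  by have := gc m (idf _) (mono_idf _); rewrite fcomp_idr HX.1 comp_idl.
by apply: un => //; rewrite -gw guv // /add_cell cell_self orbT.
Qed.

End Class.
End Rel.

(** * Attaching families of cells *)

Definition simplex n := {m : nat & {ffun 'I_m.+1 -> 'I_n.+1}}.
Definition mksimplex n m (w : {ffun 'I_m.+1 -> 'I_n.+1}) : simplex n :=
  Tagged (fun m => {ffun 'I_m.+1 -> 'I_n.+1}) w.

Lemma mksimplex_inj n m : injective (@mksimplex n m).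
Proof. by move=> a b; apply: eq_from_Tagged. Qed.

Definition add_cells n (S : subcx n) (L : seq (simplex n)) : subcx n :=
  fun q s => S q s || has (fun w => cell (tagged w) s) L.

Lemma add_cells_closed n (S : subcx n) L : face_closed S -> face_closed (add_cells S L).
Proof.
move=> Scl m m' s t /orP[Ss|/hasP[w wL ws]] mt; apply/orP; [left|right].
  exact: Scl.
by apply/hasP; exists w => //; apply: cell_closed.
Qed.

Lemma add_cells_self n (S : subcx n) L w : w \in L -> add_cells S L (tagged w).
Proof. by move=> wL; apply/orP; right; apply/hasP; exists w => //; apply: cell_self. Qed.

Lemma add_cells_base n (S : subcx n) L : subcx_le S (add_cells S L).
Proof. by move=> m s Ss; rewrite /add_cells Ss. Qed.

Lemma add_cells_mono n (S : subcx n) L L' :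
  {subset L <= L'} -> subcx_le (add_cells S L) (add_cells S L').
Proof.
move=> LL m s /orP[Ss|/hasP[w /LL wL ws]]; apply/orP; [by left|right].
by apply/hasP; exists w.
Qed.

Section Cells.
Variables (n : nat) (S : subcx n) (U : pred (simplex n)) (key : simplex n -> nat).

(** Lists are attached from the tail, so a decreasing [key] along the list is an increasing one in
    the order of attachment. For the same reason [cells_below] puts the higher dimension in
    front. *)
Definition cells_of_dim m : seq (simplex n) :=
  sort (fun a b => key b <= key a)
    [seq w <- [seq mksimplex w | w <- enum {ffun 'I_m.+1 -> 'I_n.+1}] | U w].

Fixpoint cells_below m : seq (simplex n) :=
  if m is m'.+1 then cells_of_dim m' ++ cells_below m' else [::].

Lemma mem_cells_of_dim m w : (w \in cells_of_dim m) = U w && (tag w == m).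
Proof.
rewrite mem_sort mem_filter; congr (_ && _); apply/mapP/eqP => [[v _ -> //]|<-].
by exists (tagged w); rewrite ?mem_enum //; case: w.
Qed.

Lemma mem_cells_below m w : (w \in cells_below m) = U w && (tag w < m).
Proof.
elim: m => [|m IH] /=; first by rewrite andbF.
by rewrite mem_cat mem_cells_of_dim IH ltnS [in RHS]leq_eqVlt -andb_orr.
Qed.

(* The cells attached when [w] is, in the order given by dimension and then [key]. *)
Definition attaching_stage (w : simplex n) (L : seq (simplex n)) : Prop :=
  [/\ U w, w \notin L,
      forall v, v \in L -> U v /\ (tag v < tag w \/ tag v = tag w /\ key v <= key w)
    & forall v, U v -> tag v < tag w \/ tag v = tag w /\ key v < key w -> v \in L].

Variables (C : category) (W : morclass C).
Hypothesis HW : stable_class W.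
Variables (X Y : sdata C) (f : simp_map X Y).

Lemma rel_cells_of_dim m :
  (forall w L, tag w = m -> attaching_stage w L ->
     relrep W f (add_cells S L) (add_cell (add_cells S L) (tagged w))) ->
  relrep W f (add_cells S (cells_below m)) (add_cells S (cells_below m.+1)).
Proof.
move=> step /=; set D := cells_of_dim m; set E := cells_below m.
have tr : transitive (fun a b : simplex n => key b <= key a).
  by move=> b a c ba cb; apply: leq_trans ba.
have sD : pairwise (fun a b => key b <= key a) D.
  by rewrite -sorted_pairwise // sort_sorted // => a b; apply: leq_total.
have uD : uniq D.
  rewrite sort_uniq filter_uniq // map_inj_uniq ?enum_uniq //.
  exact: mksimplex_inj.
(* Induction on the suffix [D2] attached so far; [D1] holds the cells of this dimension still to
   come. *)
suff: forall D2 D1, D = D1 ++ D2 -> relrep W f (add_cells S E) (add_cells S (D2 ++ E)).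
  by move/(_ D [::]); apply.
elim=> [|w D2 IH] D1 DD; first exact: rel_refl.
have memD v : v \in D -> U v && (tag v == m) by rewrite mem_cells_of_dim.
have memE v : (v \in E) = U v && (tag v < m) by exact: mem_cells_below.
have wD : w \in D by rewrite DD mem_cat inE eqxx orbT.
have /andP[Uw /eqP tw] := memD _ wD.
apply: (rel_trans HW) (IH (rcons D1 w) _) _.
- by apply: add_cells_mono => v; rewrite mem_cat => ->; rewrite orbT.
- by apply: add_cells_mono => v; rewrite inE => ->; rewrite orbT.
- by rewrite cat_rcons.
apply: (rel_eq _ _ (step w (D2 ++ E) tw _)) => //.
  by move=> q s; rewrite /add_cell /add_cells /= orbAC -orbA.
move: uD sD; rewrite DD cat_uniq pairwise_cat /= => /and4P[_ _ wD2 _].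
move=> /and3P[/allrelP s1 _ /andP[/allP s2 _]].
split=> //.
- by rewrite mem_cat negb_or wD2 memE tw ltnn andbF.
- move=> v; rewrite mem_cat => /orP[vD2|]; last by rewrite memE tw => /andP[-> ->]; auto.
  have /memD /andP[-> /eqP ->] : v \in D by rewrite DD mem_cat inE vD2 !orbT.
  by split=> //; right; split=> //; apply: s2.
move=> v Uv [tv|[tv kv]]; rewrite mem_cat; first by rewrite memE Uv -tw tv orbT.
have : v \in D by rewrite mem_cells_of_dim Uv tv tw eqxx.
rewrite DD mem_cat inE => /or3P[vD1|/eqP e|-> //].
  by have := s1 _ _ vD1 (mem_head _ _); rewrite leqNgt kv.
by move: kv; rewrite e ltnn.
Qed.


Lemma rel_cells_between m k :
  (forall w L, m <= tag w < m + k -> attaching_stage w L ->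
     relrep W f (add_cells S L) (add_cell (add_cells S L) (tagged w))) ->
  relrep W f (add_cells S (cells_below m)) (add_cells S (cells_below (m + k))).
Proof.
elim: k => [|k IH] step; first by rewrite addn0; apply: rel_refl.
rewrite addnS; apply: (rel_trans HW) (IH _) (rel_cells_of_dim _).
- by apply: add_cells_mono => w; rewrite !mem_cells_below => /andP[-> /= ?]; lia.
- by apply: add_cells_mono => w; rewrite !mem_cells_below => /andP[-> /= ?]; lia.
- by move=> w L tw; apply: step; lia.
- by move=> w L tw; apply: step; lia.
Qed.

End Cells.

(** A nondegenerate simplex factors through [v] by an injective monotone map, which can only be the
    identity when the dimension of [v] is not larger. *)
Lemma cell_nondegenerate n d d' (w : {ffun 'I_d.+1 -> 'I_n.+1}) (v : {ffun 'I_d'.+1 -> 'I_n.+1}) :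
  nondegenerate w -> cell v w -> d' <= d -> mksimplex v = mksimplex w.
Proof.
move=> nw /cellP[t [mt e]] dd; rewrite e in nw *.
have ti := nondegenerate_comp_inj mt nw.
have := mono_inj_bounds ord0 mt ti => /= -[_ bd].
have e' : d' = d by lia.
by subst d'; rewrite (mono_inj_id mt ti) fcomp_idr.
Qed.

Lemma bdry_full n d (t : {ffun 'I_n.+1 -> 'I_d.+1}) :
  mono t -> ~~ bdry d _ t -> exists e, mono e /\ fcomp t e = idf _.
Proof.
move=> mt; rewrite /bdry mt /= negb_exists => /forallP full.
apply: mono_factor => //; first exact: mono_idf.
move=> y; move: (full y); rewrite negb_forall => /existsP[x]; rewrite negbK => /eqP <-.
by exists x; rewrite ffunE.
Qed.

Lemma bdry_closed n : face_closed (bdry n).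
Proof.
move=> m m' s t /andP[ms /existsP[j /forallP sj]] mt; rewrite /bdry mono_fcomp //=.
by apply/existsP; exists j; apply/forallP=> x; rewrite fcompE.
Qed.

Lemma horn_closed n (i : 'I_n.+1) : face_closed (horn i).
Proof.
move=> m m' s t /andP[ms /existsP[j /andP[ji /forallP sj]]] mt; rewrite /horn mono_fcomp //=.
by apply/existsP; exists j; rewrite ji; apply/forallP=> x; rewrite fcompE.
Qed.

Lemma bdry_simp n : subcx_le (bdry n) (simp n).
Proof. by move=> m s /andP[]. Qed.

Lemma horn_simp n (i : 'I_n.+1) : subcx_le (horn i) (simp n).
Proof. by move=> m s /andP[]. Qed.

Lemma bdry_inj_dim n d (w : {ffun 'I_d.+1 -> 'I_n.+1}) : injective w -> bdry n _ w -> d < n.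
Proof.
move=> wi /andP[mw /existsP[j /forallP wj]].
case: n j w wi mw wj => [|n] j w wi mw wj.
  by have := wj ord0; rewrite (ord1 j) (ord1 (w _)) eqxx.
have [e [me we]] := mono_skip mw wj.
have ei : injective e by move=> x y exy; apply: wi; rewrite we !fcompE exy.
by have := mono_inj_bounds ord0 me ei => /= -[_ ?]; lia.
Qed.

(** * Inclusions between subcomplexes of the ordinary simplex *)

Section Thin.
Variables (C : category) (W : morclass C).
Hypothesis HW : stable_class W.
Variables (X Y : sdata C) (f : simp_map X Y).
Hypotheses (HX : is_simplicial X) (HY : is_simplicial Y) (Hf : smor X Y f).

(** The new nondegenerate simplices are attached by increasing dimension, each along its whole
    boundary. They stop at dimension [n], and their order within a dimension is immaterial, hence
    the constant key. *)
Lemma rel_thin n (S T : subcx n) :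
  face_closed S -> face_closed T -> subcx_le S T -> subcx_le T (simp n) ->
  (forall d (w : {ffun 'I_d.+1 -> 'I_n.+1}), injective w -> T d w -> ~~ S d w ->
     cell_rel W f (bdry d)) ->
  relrep W f S T.
Proof.
move=> Scl Tcl ST Ts R.
pose U : pred (simplex n) :=
  fun v => [&& T _ (tagged v), ~~ S _ (tagged v) & injectiveb (tagged v)].
have := @rel_cells_between n S U (fun _ => 0) C W HW X Y f 0 n.+1.
rewrite add0n => RR; apply: (rel_eq _ _ (RR _)) => {RR}.
- by move=> q s; rewrite /add_cells /= orbF.
- move=> q s; apply/idP/idP.
    case/orP=> [/ST //|/hasP[v]]; rewrite mem_cells_below => /andP[/and3P[Tv _ _] _].
    by move=> /cellP[t [mt ->]]; apply: Tcl.
  move=> Tqs; have [d [w [t [e [[nw mt me sw ws] dq]]]]] := nondegenerate_factor s.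
  have Tw : T d w by rewrite ws; apply: Tcl.
  have wi := mono_nondegenerate_inj (Ts _ _ Tw) nw.
  rewrite sw; apply: add_cells_closed => //.
  have [Sw|nSw] := boolP (S d w); first exact: add_cells_base.
  apply: (@add_cells_self _ _ _ (mksimplex w)); rewrite mem_cells_below /U /= Tw nSw /=.
  have -> /= : injectiveb w by apply/injectiveP.
  by have := mono_inj_bounds ord0 (Ts _ _ Tw) wi => /= -[_ ?]; lia.
move=> [d w] L _ [/and3P[/= Tw nSw /injectiveP wi] wL L1 L2].
have Lcl : face_closed (add_cells S L) by apply: add_cells_closed.
have nLw : ~~ add_cells S L w.
  apply/negP=> /orP[|/hasP[[d' v] vL vw]]; first by apply/negP.
  have [_ dd] := L1 _ vL; have {}dd : d' <= d by case: dd => /= [|[-> _]] //; lia.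
  have := cell_nondegenerate (inj_nondegenerate wi) vw dd.
  by move=> e; move: wL; rewrite -[existT _ _ _]e vL.
apply: (@rel_add_cell C W X Y f n (add_cells S L) d (bdry d) w) => //.
- exact: bdry_simp.
- move=> q t mt; apply/idP/idP => [|Lt].
    case: d w t Tw nSw wi wL L1 L2 nLw mt => [|d] w t Tw nSw wi wL L1 L2 nLw mt.
      by move=> /andP[_ /existsP[j /forallP/(_ ord0)]]; rewrite (ord1 j) (ord1 (t _)) eqxx.
    move=> /andP[_ /existsP[j /forallP tj]]; have [e [me ->]] := mono_skip mt tj.
    rewrite -fcompA; apply: Lcl => //.
    have Tv : T d (fcomp w (coface j)) by apply: Tcl => //; apply: coface_mono.
    have [Sv|nSv] := boolP (S d (fcomp w (coface j))); first exact: add_cells_base.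
    apply: (@add_cells_self _ _ _ (mksimplex (fcomp w (coface j)))).
    apply: L2; last by left.
    rewrite /U /= Tv nSv; apply/injectiveP=> x y.
    by rewrite !fcompE => /wi/coface_inj.
  (* A [t] outside the boundary has a section [e], which would make [w] a face of a simplex already
     attached. *)
  apply: contraT => /(bdry_full mt)[e [me te]].
  by move: nLw; rewrite -[w]fcomp_idr -te -fcompA Lcl.
- move=> q t t' mt mt' _ e; apply/ffunP=> x; apply: wi.
  by have /ffunP/(_ x) := e; rewrite !fcompE.
- exact: R wi Tw nSw.
Qed.

End Thin.

(** * Existence of finite mapping spaces *)

Section Representation.
Variable C : category.

(* [P], with [g] and [y], represents Map(S -> Delta^n, f). *)
Definition rel_object (X Y : sdata C) (f : simp_map X Y) n (S : subcx n) (P : C)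
    (g : fam X n P) (y : hom P (sob Y n)) : Prop :=
  [/\ cone S g, (forall m s, S m s -> f m \c g m s = smap Y s \c y),
      (forall A (g' : fam X n A) (y' : hom A (sob Y n)), cone S g' ->
         (forall m s, S m s -> f m \c g' m s = smap Y s \c y') ->
         exists h : hom A P, (forall m s, S m s -> g m s \c h = g' m s) /\ y \c h = y')
    & (forall A (h h' : hom A P), (forall m s, S m s -> g m s \c h = g m s \c h') ->
         y \c h = y \c h' -> h = h')].

Hypothesis HC : has_finite_limits C.

(** It is enough to treat the universal family: for any other one the map asked for is the pullback
    of [q] along the classifying map, and [W] is stable under pullback. *)
Lemma cell_rel_of_object (W : morclass C) (X Y : sdata C) (f : simp_map X Y) m (K : subcx m)
    (P : C) (g : fam X m P) (y : hom P (sob Y m)) (q : hom (sob X m) P) :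
  stable_class W -> rel_object f K g y ->
  (forall l t, K l t -> g l t \c q = smap X t) -> y \c q = f m -> W _ _ q ->
  cell_rel W f K.
Proof.
move=> [_ _ Wpb] [cg fg ex un] gq yq Wq A k z ck fk.
have [a [ka za]] := ex A k z ck fk.
have [Q [p1 [p2 pb]]] := HC.2 _ _ _ q a.
have [sq univ] := pb.
exists Q, p2, p1; split.
- exact: Wpb Wq pb.
- by move=> l t Kt; rewrite -gq // -comp_assoc sq comp_assoc ka.
- by rewrite -yq -comp_assoc sq comp_assoc za.
- move=> B b x kx fx.
  have [|u [[u1 u2] _]] := univ B x b; last by exists u.
  apply: un => [l t Kt|].
    by rewrite !comp_assoc gq // ka // kx.
  by rewrite !comp_assoc yq za.
move=> B u v e2 e1; have [|h [_ uh]] := univ B (p1 \c u) (p2 \c u).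
  by rewrite !comp_assoc sq.
by rewrite -(uh u) // -(uh v) // e1 e2.
Qed.

Section Objects.
Variables (X Y : sdata C) (f : simp_map X Y).
Hypotheses (HX : is_simplicial X) (HY : is_simplicial Y) (Hf : smor X Y f).

Definition collapse m : {ffun 'I_m.+1 -> 'I_1} := [ffun _ => ord0].

Lemma to_point m (t : {ffun 'I_m.+1 -> 'I_1}) : t = collapse m.
Proof. by apply/ffunP=> x; rewrite (ord1 (t x)) ffunE. Qed.

Lemma mono_collapse m : mono (collapse m).
Proof. exact: mono_cst. Qed.

(** Over the vertex [v] alone the relative mapping space is the pullback of [f 0] along evaluation
    at [v], and from there [S] is reached by an inclusion that is good for the class of all
    morphisms. The family [g] is constant because every simplex of [cell v] is a degeneracy of
    [v]. *)
Lemma rel_object_of_vertex n (S : subcx n) (v : {ffun 'I_1 -> 'I_n.+1}) :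
  S 0 v -> face_closed S -> subcx_le S (simp n) ->
  relrep (fun _ _ _ => True) f (cell v) S ->
  exists P (g : fam X n P) y, rel_object f S g y.
Proof.
move=> Sv Scl Ss R; have cY := cone_canon (n := n) HY.
have [A [a1 [a2 [sq univ]]]] := HC.2 _ _ _ (f 0) (smap Y v).
have mv : mono v := Ss _ _ Sv.
have vS : subcx_le (cell v) S by move=> m s /cellP[t [mt ->]]; apply: Scl.
pose g : fam X n A := fun m s => smap X (collapse m) \c a1.
have [|||P [c [g' [_ cg' e1 e2 [ex un]]]]] := R A g (fcompm (canon Y n) a2).
- move=> m m' s t _ mt; rewrite /g comp_assoc -HX.2 ?mono_collapse //.
  by rewrite (to_point (fcomp _ _)).
- by apply: cone_comp; apply: cone_le cY.
- move=> m s /cellP[t [mt ->]]; rewrite /g /fcompm /canon (to_point t).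
  by rewrite comp_assoc Hf ?mono_collapse // HY.2 ?mono_collapse // -!comp_assoc sq.
have a1c : a1 \c c = g' 0 v.
  by rewrite e1 ?cell_self // /g -(to_point (idf 1)) HX.1 comp_idl.
exists P, g', (a2 \c c); split=> //.
- by move=> m s /e2 ->; rewrite comp_assoc.
- move=> B k y ck fk; have [|b [[b1 b2] _]] := univ B (k 0 v) y; first exact: fk.
  have [//||m s Sms|u [cu gu]] := ex B b k.
  + move=> m s /cellP[t [mt ->]]; rewrite ck // /g -comp_assoc b1.
    by rewrite (to_point t).
  + by rewrite fk // /fcompm /canon -comp_assoc b2.
  by exists u; split=> //; rewrite -comp_assoc cu.
move=> B h h' gh yh; apply: un => //.
have [|k [_ uk]] := univ B (a1 \c c \c h) (a2 \c c \c h).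
  by rewrite !comp_assoc sq.
have <- : k = c \c h by apply: uk; rewrite !comp_assoc.
by apply: uk; rewrite !comp_assoc a1c gh.
Qed.

Lemma cell_rel_point (W : morclass C) : stable_class W -> W _ _ (f 0) -> cell_rel W f (bdry 0).
Proof.
have emp q (t : {ffun 'I_q.+1 -> 'I_1}) : bdry 0 _ t = false.
  apply/negP=> /andP[_ /existsP[j /forallP/(_ ord0)]].
  by rewrite (ord1 j) (ord1 (t _)) eqxx.
move=> [_ _ Wpb] Wf A g y _ _.
have [Q [p1 [p2 pb]]] := HC.2 _ _ _ (f 0) y; have [sq univ] := pb.
exists Q, p2, p1; split=> //.
- exact: Wpb Wf pb.
- by move=> q t; rewrite emp.
- by move=> B b z _ /univ[u [[u1 u2] _]]; exists u.
move=> B u v e2 e1; have [|h [_ uh]] := univ B (p1 \c u) (p2 \c u).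
  by rewrite !comp_assoc sq.
by rewrite -(uh u) // -(uh v) // e1 e2.
Qed.

Lemma bdry_vertex m : bdry m.+1 _ ([ffun _ => ord0] : {ffun 'I_1 -> 'I_m.+2}).
Proof.
rewrite /bdry mono_cst; apply/existsP; exists ord_max; apply/forallP=> x.
by rewrite ffunE.
Qed.

Lemma rel_object_bdry m :
  (forall d, d < m.+1 -> cell_rel (fun _ _ _ => True) f (bdry d)) ->
  exists P (g : fam X m.+1 P) y, rel_object f (bdry m.+1) g y.
Proof.
move=> R; apply: (rel_object_of_vertex (bdry_vertex m)).
- exact: bdry_closed.
- exact: bdry_simp.
apply: rel_thin => //.
- exact: cell_closed.
- exact: bdry_closed.
- by move=> q s /cellP[t [mt ->]]; apply: bdry_closed => //; apply: bdry_vertex.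
- exact: bdry_simp.
by move=> d w wi bw _; apply: R; apply: bdry_inj_dim bw.
Qed.

(** Induction in two alternating steps: attaching cells of lower dimension produces the mapping
    space of the boundary, and pulling back the map from [X_d] to that space attaches a [d]-cell. *)
Lemma cell_rel_top d : cell_rel (fun _ _ _ => True) f (bdry d).
Proof.
elim/ltn_ind: d => -[|d] IH; first exact: cell_rel_point.
have [P [g [y ob]]] := rel_object_bdry IH; have [_ _ ex _] := ob.
have [||q [gq yq]] := ex (sob X d.+1) (canon X d.+1) (f d.+1).
- by apply: cone_le (cone_canon HX); apply: bdry_simp.
- by move=> m' s /bdry_simp ms; rewrite /canon Hf.
exact: (cell_rel_of_object _ ob gq yq).
Qed.

Lemma rel_object_ex n (S : subcx n) (v : {ffun 'I_1 -> 'I_n.+1}) :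
  S 0 v -> face_closed S -> subcx_le S (simp n) ->
  exists P (g : fam X n P) y, rel_object f S g y.
Proof.
move=> Sv Scl Ss; apply: (rel_object_of_vertex Sv) => //.
apply: rel_thin => //; first exact: cell_closed.
  by move=> q s /cellP[t [mt ->]]; apply: Scl.
by move=> d w _ _ _; apply: cell_rel_top.
Qed.

End Objects.
End Representation.

(** * Comparison with the records [relmap] and [mapobj] *)

Section RelMapObjects.
Variables (C : category) (X Y : sdata C) (f : simp_map X Y).
Hypotheses (HX : is_simplicial X) (HY : is_simplicial Y) (Hf : smor X Y f).

(* [mlift] and [rlift] are total; on families that are not cones they are given the lift of a
   constant cone. *)
Lemma rel_object_lift n (S : subcx n) P (g : fam X n P) y :
  subcx_le S (simp n) -> rel_object f S g y ->
  forall A (k : fam X n A) (z : hom A (sob Y n)), exists h : hom A P,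
    cone S k -> (forall m s, S m s -> f m \c k m s = smap Y s \c z) ->
    (forall m s, S m s -> g m s \c h = k m s) /\ y \c h = z.
Proof.
move=> Ss [_ _ ex _] A k z.
case: (pselect (cone S k /\ forall m s, S m s -> f m \c k m s = smap Y s \c z)) => [[ck fk]|no].
  by have [h hk] := ex A k z ck fk; exists h.
pose x := k 0 [ffun _ => ord0].
have [||h _] := ex A (fun m _ => smap X (collapse m) \c x) (smap Y (collapse n) \c f 0 \c x).
- move=> m m' s t _ mt; rewrite comp_assoc -HX.2 ?mono_collapse //.
  by rewrite (to_point (fcomp _ _)).
- move=> m s /Ss ms; rewrite !comp_assoc Hf ?mono_collapse // -HY.2 ?mono_collapse //.
  by rewrite (to_point (fcomp _ _)).
by exists h => ck fk; case: no.
Qed.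

(** The hypercover condition quantifies over records [relmap]; to make use of it one such record has
    to be built. *)
Lemma relmap_of_object n (S : subcx n) P (g : fam X n P) y :
  subcx_le S (simp n) -> rel_object f S g y -> exists _ : relmap X Y f n S (simp n), True.
Proof.
move=> Ss ob; have [cg fg ex un] := ob.
pose lift A k z := projT1 (cid (rel_object_lift Ss ob (A := A) k z)).
have liftP A (k : fam X n A) z := projT2 (cid (rel_object_lift Ss ob (A := A) k z)).
have Yid A (k : fam Y n A) m (s : {ffun 'I_m.+1 -> 'I_n.+1}) :
    cone (simp n) k -> mono s -> k m s = smap Y s \c k n (idf _).
  by move=> ck ms; rewrite -ck ?fcomp_idl //; apply: mono_idf.
unshelve eexists; last by [].
refine (@RelMap C X Y f n S (simp n) P g (fun m s => smap Y s \c y) cg _ fg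
  (fun A k k' => lift A k (k' n (idf _))) _ _).
- by move=> m m' s t ms mt; rewrite HY.2 // comp_assoc.
- move=> A k k' ck ck' fk; have [||h1 h2] := liftP A k (k' n (idf _)) => //.
    by move=> m s Sms; rewrite fk // Yid //; exact (Ss _ _ Sms).
  by split=> // m s ms; rewrite -comp_assoc h2 -Yid.
- move=> A h h' e1 e2; apply: un => //.
  by have := e2 n (idf _) (mono_idf _); rewrite HY.1 !comp_idl.
Qed.

Lemma relmap_object n (S : subcx n) (P : relmap X Y f n S (simp n)) :
  subcx_le S (simp n) -> rel_object f S (ru _ _ _ _ _ _ _ P) (rv _ _ _ _ _ _ _ P _ (idf n.+1)).
Proof.
move=> Ss.
have Yid A (k : fam Y n A) m (s : {ffun 'I_m.+1 -> 'I_n.+1}) :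
    cone (simp n) k -> mono s -> k m s = smap Y s \c k n (idf _).
  by move=> ck ms; rewrite -ck ?fcomp_idl //; apply: mono_idf.
have cv := rv_cone _ _ _ _ _ _ _ P; split.
- exact: ru_cone.
- by move=> m s Sms; rewrite -Yid ?r_compat //; apply: Ss.
- move=> A k z ck fk.
  have [//|||e1 e2] := rlift_spec _ _ _ _ _ _ _ P A k (fcompm (canon Y n) z).
  + exact/cone_comp/cone_canon.
  + by move=> m s /fk.
  exists (rlift P k (fcompm (canon Y n) z)); split=> //.
  by rewrite e2 /simp ?mono_idf // /fcompm /canon HY.1 comp_idl.
- move=> A h h' e1 e2; apply: (r_uniq _ _ _ _ _ _ _ P) => // m s ms.
  by rewrite (Yid _ _ _ _ cv ms) -!comp_assoc e2.
Qed.

End RelMapObjects.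

Section MapObjects.
Variables (C : category) (t : C).
Hypothesis Ht : is_terminal t.

Definition to_terminal (a : C) : hom a t := projT1 (cid (Ht a)).

Lemma terminal_unique (a : C) (u v : hom a t) : u = v.
Proof. by have [h [_ uh]] := Ht a; rewrite -(uh u) // -(uh v). Qed.

Definition point : sdata C := @SData C (fun _ => t) (fun _ _ _ => idm t).
(** Absolute mapping spaces are relative ones over the terminal simplicial object, so the relative
    lemmas also serve for [X] alone. *)
Definition to_pt (X : sdata C) : simp_map X point := fun n => to_terminal (sob X n).

Lemma point_simplicial : is_simplicial point.
Proof. by split=> [m|m m' m'' s u _ _] /=; rewrite ?comp_idl. Qed.

Lemma to_pt_smor X : smor X point (to_pt X).
Proof. by move=> m m' s ms; apply: terminal_unique. Qed.

Lemma mapobj_object X n (S : subcx n) (M : mapobj X n S) :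
  rel_object (to_pt X) S (@mu C X n S M) (to_terminal (mo M)).
Proof.
split.
- exact: mu_cone.
- by move=> m s _; apply: terminal_unique.
- move=> A k z ck _; exists (mlift M k); split; last exact: terminal_unique.
  exact: mlift_spec.
- by move=> A h h' e _; apply: (m_uniq _ _ _ _ M).
Qed.

Lemma mapobj_of_object X n (S : subcx n) P (g : fam X n P) y :
  is_simplicial X -> subcx_le S (simp n) -> rel_object (to_pt X) S g y ->
  exists _ : mapobj X n S, True.
Proof.
move=> HX Ss ob; have [cg fg ex un] := ob.
have L := rel_object_lift HX point_simplicial (@to_pt_smor X) Ss ob.
unshelve eexists; last by [].
refine (@MapObj C X n S P g cg (fun A k => projT1 (cid (L A k (to_terminal A)))) _ _).
- move=> A k ck; have [//||h1 h2] := projT2 (cid (L A k (to_terminal A))) => //.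
  by move=> m s _; apply: terminal_unique.
- by move=> A h h' e; apply: un => //; apply: terminal_unique.
Qed.

Lemma mapobj_ex (X : sdata C) n (S : subcx n) (v : {ffun 'I_1 -> 'I_n.+1}) :
  has_finite_limits C -> is_simplicial X -> S 0 v -> face_closed S -> subcx_le S (simp n) ->
  exists _ : mapobj X n S, True.
Proof.
move=> HC HX Sv Scl Ss.
have [P [g [y]]] := rel_object_ex HC HX point_simplicial (@to_pt_smor X) Sv Scl Ss.
exact: mapobj_of_object.
Qed.

End MapObjects.

(** * Passage to the limit and inner matchings *)

Lemma rel_sub (C : category) (W W' : morclass C) X Y (f : simp_map X Y) n (S T : subcx n) :
  (forall a b (h : hom a b), W _ _ h -> W' _ _ h) -> relrep W f S T -> relrep W' f S T.
Proof.
move=> WW R A g h cg ch fgh; have [P [c [g' [Wc *]]]] := R A g h cg ch fgh.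
by exists P, c, g'; split=> //; apply: WW.
Qed.

(** For isomorphisms a family on [T 0] extends to every [T k] over the same [A], and uniquely; so
    the extensions agree and define one on the union. With covers, each stage would replace [A] by a
    new object. *)
Lemma rel_iso_limit (C : category) X Y (f : simp_map X Y) n (T : nat -> subcx n) (U : subcx n) :
  (forall k, relrep (@is_iso C) f (T 0) (T k)) ->
  (forall k l, k <= l -> subcx_le (T k) (T l)) ->
  face_closed U -> (forall k, subcx_le (T k) U) -> (forall m s, U m s -> T m.+1 m s) ->
  relrep (@is_iso C) f (T 0) U.
Proof.
move=> R Tle Ucl TU UT A g h cg ch fgh.
have ex k : exists gk : fam X n A, [/\ cone (T k) gk,
    (forall m s, T 0 m s -> gk m s = g m s), (forall m s, T k m s -> f m \c gk m s = h m s)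
  & forall B (b : hom B A) (k' : fam X n B), cone (T k) k' ->
      (forall m s, T 0 m s -> k' m s = g m s \c b) ->
      (forall m s, T k m s -> f m \c k' m s = h m s \c b) ->
      forall m s, T k m s -> k' m s = gk m s \c b].
  have [||//|P [c [g' [[d [dc cd]] cg' e1 e2 [ex un]]]]] := R k A g h => //.
    exact: cone_le ch.
  exists (fcompm g' d); split.
  - exact: cone_comp.
  - by move=> m s Ts; rewrite /fcompm e1 // -comp_assoc cd comp_idr.
  - by move=> m s Ts; rewrite /fcompm comp_assoc e2 // -comp_assoc cd comp_idr.
  move=> B b k' ck' k1 k2 m s Ts; have [u [cu gu]] := ex B b k' ck' k1 k2.
  by rewrite -gu // /fcompm -cu -comp_assoc (comp_assoc d) dc comp_idl.
have [G GP] := choice ex.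
have GG k l m s : k <= l -> T k m s -> G l m s = G k m s.
  move=> kl Ts; have [ck gk fk uk] := GP k; have [cl gl fl _] := GP l.
  rewrite (uk A (idm A) (G l)) ?comp_idr //.
  - exact: cone_le (Tle _ _ kl) cl.
  - by move=> m' s' /gl ->; rewrite comp_idr.
  - by move=> m' s' /(Tle _ _ kl) /fl ->; rewrite comp_idr.
(* An [m]-simplex of [U] is sure to be present at stage [m.+1], so its value is read off there. *)
exists A, (idm A), (fun m s => G m.+1 m s); split.
- exact: iso_id.
- move=> m m' s t Us mt; pose l := maxn m.+1 m'.+1.
  have Ts := UT _ _ Us; have Tst := UT _ _ (Ucl _ _ _ _ Us mt).
  rewrite -(GG _ l _ _ _ Tst) ?leq_maxr // -(GG _ l _ _ _ Ts) ?leq_maxl //.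
  by have [cl _ _ _] := GP l; apply: cl => //; apply: Tle Ts; apply: leq_maxl.
- by move=> m s Ts; have [_ -> // _ _] := GP m.+1; rewrite comp_idr.
- by move=> m s /UT Ts; have [_ _ -> // _] := GP m.+1; rewrite comp_idr.
split=> [B b k ck k1 k2|B u v]; last by rewrite !comp_idl.
exists b; split; first by rewrite comp_idl.
move=> m s /UT Ts; have [_ _ _ uk] := GP m.+1.
rewrite (uk B b k) //; first exact: cone_le ck.
by move=> m' s' /TU /k2.
Qed.

(** * Simplices as words, and inner matchings of words *)

Definition word m n (s : {ffun 'I_m.+1 -> 'I_n.+1}) : seq nat :=
  [seq nat_of_ord (s x) | x <- enum 'I_m.+1].

Lemma size_word m n (s : {ffun 'I_m.+1 -> 'I_n.+1}) : size (word s) = m.+1.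
Proof. by rewrite size_map size_enum_ord. Qed.

Lemma nth_word m n (s : {ffun 'I_m.+1 -> 'I_n.+1}) (x : 'I_m.+1) : nth 0 (word s) x = s x.
Proof. by rewrite (nth_map ord0) ?size_enum_ord // nth_ord_enum. Qed.

Lemma mem_word m n (s : {ffun 'I_m.+1 -> 'I_n.+1}) (j : 'I_n.+1) :
  (nat_of_ord j \in word s) = [exists x, s x == j].
Proof.
apply/mapP/existsP => [[x _ /val_inj ->]|[x /eqP <-]]; exists x => //.
by rewrite mem_enum.
Qed.

Lemma word_bound m n (s : {ffun 'I_m.+1 -> 'I_n.+1}) : all (geq n) (word s).
Proof. by apply/allP=> _ /mapP[x _ ->] /=; rewrite -ltnS. Qed.

Lemma word_inj_dim m n : injective (@word m n).
Proof. by move=> s s' e; apply/ffunP=> x; apply/val_inj; rewrite /= -!nth_word e. Qed.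

Lemma word_inj n (v w : simplex n) : word (tagged v) = word (tagged w) -> v = w.
Proof.
case: v w => m v [m' w] /= e.
have em : m' = m by have := congr1 size e; rewrite !size_word => -[].
by subst m'; congr existT; apply: word_inj_dim.
Qed.

Lemma word_coface m n (w : {ffun 'I_m.+2 -> 'I_n.+1}) (j : 'I_m.+2) a d b :
  word w = a ++ d :: b -> j = size a :> nat -> word (fcomp w (coface j)) = a ++ b.
Proof.
move=> e ja; have := size_word w; rewrite e size_cat /= => sz.
apply: (@eq_from_nth _ 0) => [|x]; rewrite size_word ?size_cat; first by lia.
move=> xm; rewrite (nth_word _ (Ordinal xm)) fcompE -nth_word e !nth_cat ffunE /= /bump -ja.
case: (leqP j x) => jx; first by rewrite ltnNge (leqW jx) /= add1n subSn.
by rewrite add0n jx.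
Qed.

Lemma word_ex n w : w != [::] -> all (geq n) w ->
  exists m (s : {ffun 'I_m.+1 -> 'I_n.+1}), word s = w.
Proof.
case: w => // c w _ /allP wn; exists (size w), [ffun x => inord (nth 0 (c :: w) (x : 'I_(size w).+1))].
apply: (@eq_from_nth _ 0) => [|x]; rewrite size_word // => xw.
rewrite (nth_word _ (Ordinal xw)) ffunE inordK //.
by apply: (wn (nth 0 (c :: w) x)); rewrite mem_nth.
Qed.

Definition reduced (w : seq nat) : bool := sorted (fun a b => a != b) w.

Lemma reduced_word m n (s : {ffun 'I_m.+1 -> 'I_n.+1}) : nondegenerate s <-> reduced (word s).
Proof.
split=> [ns|/(sortedP 0) ns x y yx].
  apply/(sortedP 0)=> i; rewrite size_word => im.
  by rewrite (nth_word _ (Ordinal (ltnW im))) (nth_word _ (Ordinal im)) ns.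
have := ns x; rewrite size_word -yx ltn_ord => /(_ isT).
by rewrite !nth_word.
Qed.

(* [U l c r] means that [l ++ c :: r] is matched with its face [l ++ r]; both [l] and [r]
   are nonempty, so the face is an inner one. *)
Record inner_matching n (missing : pred (seq nat)) (U : seq nat -> nat -> seq nat -> Prop)
    (key : seq nat -> nat) : Prop := InnerMatching {
  im_word : forall l c r, U l c r -> [/\ l != [::], r != [::], missing (l ++ r),
    reduced (l ++ c :: r) & reduced (l ++ r)] /\ all (geq n) (l ++ c :: r);
  im_total : forall w, missing w -> reduced w -> all (geq n) w ->
    exists l c r, U l c r /\ (w = l ++ c :: r \/ w = l ++ r);
  im_lower_upper : forall l c r l' c' r', U l c r -> U l' c' r' -> l ++ r <> l' ++ c' :: r';
  im_lower_inj : forall l c r l' c' r', U l c r -> U l' c' r' -> l ++ r = l' ++ r' ->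
    l ++ c :: r = l' ++ c' :: r';
  im_key : forall l c r l' c' r' a d b, U l c r -> U l' c' r' ->
    l ++ c :: r = a ++ d :: b -> l' ++ r' = a ++ b -> size a <> size l ->
    key (l' ++ c' :: r') < key (l ++ c :: r) }.

Lemma horn_full q m (i : 'I_m.+1) (t : {ffun 'I_q.+1 -> 'I_m.+1}) :
  mono t -> ~~ horn i _ t -> forall j, j != i -> exists x, t x = j.
Proof.
move=> mt; rewrite /horn mt /= negb_exists => /forallP nt j ji.
move: (nt j); rewrite ji /= negb_forall => /existsP[x].
by rewrite negbK => /eqP; exists x.
Qed.

(** Outside the horn, [t] meets every position except perhaps [i], so it starts at 0 and advances by
    at most one, or by two across [i]. At the first place where [t] and [t'] differ, equal letters
    of [w] would stand next to each other, against nondegeneracy, or on the two sides of [i],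
    against the hypothesis on the neighbours of [i]. *)
Lemma horn_rigid q m n (i : 'I_m.+1) (w : {ffun 'I_m.+1 -> 'I_n.+1})
  (t t' : {ffun 'I_q.+1 -> 'I_m.+1}) :
  0 < i -> nondegenerate w ->
  (forall x y : 'I_m.+1, i = x.+1 :> nat -> y = x.+2 :> nat -> w x != w y) ->
  mono t -> mono t' -> ~~ horn i _ t -> ~~ horn i _ t' -> fcomp w t = fcomp w t' -> t = t'.
Proof.
move=> i0 nw ni.
have start (u : {ffun 'I_q.+1 -> 'I_m.+1}) : mono u -> ~~ horn i _ u -> u ord0 = 0 :> nat.
  move=> mu hu; have [|x ux] := horn_full mu hu (j := ord0).
    by rewrite -val_eqE /= neq_ltn i0.
  have /monoP/(_ ord0 x isT) := mu; rewrite ux /=; lia.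
have gap (u : {ffun 'I_q.+1 -> 'I_m.+1}) (x y : 'I_q.+1) : mono u -> ~~ horn i _ u ->
    y = x.+1 :> nat -> u y <= (u x).+1 \/ (u y = (u x).+2 :> nat /\ i = (u x).+1 :> nat).
  move=> mu hu yx.
  have no j : j != i -> u x < j -> j < u y -> False.
    move=> ji xj jy; have [z uz] := horn_full mu hu ji; move: xj jy; rewrite -uz => xj jy.
    have [zx|xz] := leqP z x; first by have /monoP/(_ _ _ zx) := mu; lia.
    by have /monoP/(_ y z) := mu; rewrite yx => /(_ xz); lia.
  case: (leqP (u y) (u x).+1) => [|uxy]; [by left|right].
  have um := ltn_ord (u y).
  have xm : (u x).+1 < m.+1 by lia.
  have ix : i = (u x).+1 :> nat.
    apply/eqP/contraT => ne; case: (no (Ordinal xm)) => //=.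
    by rewrite -val_eqE /= eq_sym.
  split=> //; apply/eqP/contraT => ne.
  have x2 : (u x).+2 < m.+1 by lia.
  case: (no (Ordinal x2)) => /=; [by rewrite -val_eqE /= ix; lia|lia|].
  by rewrite ltn_neqAle uxy eq_sym ne.
have key (u v : {ffun 'I_q.+1 -> 'I_m.+1}) (x y : 'I_q.+1) : mono u -> mono v ->
    ~~ horn i _ u -> ~~ horn i _ v -> w (u y) = w (v y) -> y = x.+1 :> nat -> u x = v x ->
    ~~ (u y < v y).
  move=> mu mv hu hv wuv yx uvx; apply/negP=> lt.
  have := gap v x y mv hv yx.
  have xy : x <= y by rewrite yx.
  have := monoP _ mu _ _ xy; rewrite -uvx => uxy G.
  case: (eqVneq (v y : nat) (u y).+1) => [e|ne].
    by have := nw _ _ e; rewrite wuv eqxx.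
  have [e1 e2] : v y = (u y).+2 :> nat /\ i = (u y).+1 :> nat.
    by move: G ne lt uxy; clear; lia.
  by have := ni _ _ e2 e1; rewrite wuv eqxx.
move=> mt mt' ht ht' e; have we x : w (t x) = w (t' x).
  by have /ffunP/(_ x) := e; rewrite !fcompE.
apply/ffunP=> -[x xq]; elim: x xq => [|x IH] xq.
  apply/val_inj; rewrite /= (_ : Ordinal xq = ord0) ?start //.
  exact/val_inj.
have exx := IH (ltnW xq).
have := key t t' (Ordinal (ltnW xq)) (Ordinal xq) mt mt' ht ht' (we _) erefl exx.
have := key t' t (Ordinal (ltnW xq)) (Ordinal xq) mt' mt ht' ht (esym (we _)) erefl (esym exx).
by move=> a b; apply/val_inj/eqP; rewrite /= eqn_leq !(leqNgt (nat_of_ord _)) a b.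
Qed.

Lemma nth_skip l c r x : reduced (l ++ r) -> 0 < size r -> size l = x.+1 ->
  nth 0 (l ++ c :: r) x != nth 0 (l ++ c :: r) x.+2.
Proof.
move=> /(sortedP 0)/(_ x) H r0 lx; move: H.
rewrite size_cat lx -[X in X < _]addn0 ltn_add2l => /(_ r0); rewrite !nth_cat lx ltnSn ltnn.
by rewrite subnn ltnNge leqnSn /= subSn // subnn.
Qed.

Section Matching.
Variables (n : nat) (S : subcx n) (missing : pred (seq nat)).
Variables (U : seq nat -> nat -> seq nat -> Prop) (key : seq nat -> nat).
Hypothesis Scl : face_closed S.
Hypothesis Smissing : forall m (s : {ffun 'I_m.+1 -> 'I_n.+1}), S s = ~~ missing (word s).
Hypothesis IM : inner_matching n missing U key.

Let upper (v : simplex n) : bool :=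
  `[< exists l c r, U l c r /\ word (tagged v) = l ++ c :: r >].
Let wkey (v : simplex n) := key (word (tagged v)).

(** The nondegenerate core of [s] is the upper or the lower word of a pair and lies in the upper
    cell in both cases. That cell has larger dimension than [s] only if [s] is itself the lower
    word. *)
Lemma missing_factor m (s : {ffun 'I_m.+1 -> 'I_n.+1}) :
  ~~ S s -> exists d (v : {ffun 'I_d.+1 -> 'I_n.+1}) l c r,
    [/\ U l c r, word v = l ++ c :: r, cell v s
      & d <= m \/ d = m.+1 /\ word s = l ++ r].
Proof.
move=> nSs; have [d [w [t [e [[nw mt me sw ws] dm]]]]] := nondegenerate_factor s.
have nSw : ~~ S w by apply: contra nSs => Sw; rewrite sw Scl.
have := im_total IM _ (proj1 (reduced_word w) nw) (word_bound w).
rewrite -[missing _]negbK -Smissing nSw => /(_ isT) [l [c [r [Ulcr [wu|wl]]]]].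
  exists d, w, l, c, r; split=> //; last by left.
  by rewrite sw; apply/cellP; exists t.
have [[l0 r0 _ _ _] lcr] := im_word IM Ulcr.
have [||d' [v vl]] := @word_ex n (l ++ c :: r) => //; first by case: (l).
have := size_word v; have := size_word w; rewrite vl wl !size_cat /= => sw1 sw2.
have ed : d' = d.+1 by lia.
subst d'; have li : size l < d.+2 by lia.
have wv : w = fcomp v (coface (Ordinal li)).
  by apply: word_inj_dim; rewrite wl (word_coface (a := l) (d := c) (b := r)).
exists d.+1, v, l, c, r; split=> //.
  rewrite sw wv; apply/cellP; exists (fcomp (coface (Ordinal li)) t).
  by rewrite fcompA mono_fcomp // coface_mono.
case: (ltngtP d m) dm => // [dm _|dm _]; first by left.
right; split; first by rewrite dm.
subst d; suff -> : s = w by [].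
have ei : injective e by apply: (@nondegenerate_comp_inj _ _ _ s e) => //; rewrite -ws.
by rewrite ws (mono_inj_id me ei) fcomp_idr.
Qed.

Variables (C : category) (W : morclass C).
Hypothesis HW : stable_class W.
Variables (X Y : sdata C) (f : simp_map X Y).
Hypotheses (HX : is_simplicial X) (HY : is_simplicial Y) (Hf : smor X Y f).

(** The cell of [w] meets the part already built in exactly the horn that omits its matched face
    [u]: by [nLu] that face is new, and by [hornP] the other faces are present. Acyclicity, in the
    form [im_key], enters on both sides. *)
Lemma rel_matching_step w L :
  (forall i : 'I_(tag w).+1, 0 < i < tag w -> cell_rel W f (horn i)) ->
  attaching_stage upper wkey w L ->
  relrep W f (add_cells S L) (add_cell (add_cells S L) (tagged w)).
Proof.
case: w => m w /= R [/asboolP[l [c [r [Ulcr /= wE]]]] wL L1 L2].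
have [[l0 r0 miss red redf] bnd] := im_word IM Ulcr.
have := size_word w; rewrite wE size_cat /=.
have {}l0 : 0 < size l by case: (l) l0.
have {}r0 : 0 < size r by case: (r) r0.
case: m w R wE wL L1 L2 => [|m] w R wE wL L1 L2 sz; first by lia.
have im : size l < m.+2 by lia.
pose i := Ordinal im.
have Lcl : face_closed (add_cells S L) by apply: add_cells_closed.
have nw : nondegenerate w by apply/reduced_word; rewrite wE.
pose u := fcomp w (coface i).
have wu : word u = l ++ r by apply: (word_coface wE).
have nu : nondegenerate u by apply/reduced_word; rewrite wu.
have nLu : ~~ add_cells S L u.
  (* Suppose an earlier [v] contains [u]. In dimension at most [m] it would equal [u], a lower and
     not an upper word. In the dimension of [w], it equals [w] if [u] is its matched face, and has a
     larger key than [w] if [u] is another face. *)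
  rewrite /add_cells Smissing wu miss /=; apply/hasP=> -[[d v] vL /= vu].
  have [/asboolP[l' [c' [r' [Ul' /= vE]]]] dm] := L1 _ vL.
  have /cellP[t [mt ut]] := vu.
  have ti : injective t by apply: (@nondegenerate_comp_inj _ _ _ v t) => //; rewrite -ut.
  have [dm'|md] := leqP d m.
    have e := congr1 (fun z : simplex n => word (tagged z)) (cell_nondegenerate nu vu dm').
    by have := im_lower_upper IM Ulcr Ul'; rewrite -wu -vE; apply.
  have [ed kv] : d = m.+1 /\ wkey (mksimplex v) <= wkey (mksimplex w).
    by case: dm => [dm|[dm kv]]; [by move: (leq_trans dm md); rewrite ltnn|split].
  subst d; have [j tj] := mono_inj_coface mt ti.
  have := size_word v => szv.
  have jv : j < size (word v) by rewrite szv.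
  pose a := take j (word v); pose b := drop j.+1 (word v).
  have vab : word v = a ++ nth 0 (word v) j :: b by rewrite -drop_nth // cat_take_drop.
  have sa : j = size a :> nat by rewrite size_takel // ltnW.
  have uab : word u = a ++ b by rewrite ut tj (word_coface vab).
  have [al|al] := eqVneq (size a) (size l').
    have : word w = word v.
      rewrite wE vE; apply: (im_lower_inj IM Ulcr Ul'); rewrite -wu uab.
      move: vab; rewrite vE => /eqP; rewrite eqseq_cat // => /andP[/eqP -> /eqP[_ ->]] //.
    move/(@word_inj n (mksimplex w) (mksimplex v)) => e.
    by move: wL; rewrite -[existT _ _ _]/(mksimplex w) e vL.
  have := im_key IM Ul' Ulcr (a := a) (d := nth 0 (word v) j) (b := b).
  rewrite -vE -vab -wu uab => /(_ erefl erefl) H.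
  by have := H (elimN eqP al); rewrite -wE ltnNge kv.
have hornP q (t : {ffun 'I_q.+1 -> 'I_m.+2}) : mono t -> horn i _ t = add_cells S L (fcomp w t).
  move=> mt; apply/idP/idP => [/andP[_ /existsP[j /andP[ji /forallP tj]]]|].
    have [e [me ->]] := mono_skip mt tj; rewrite -fcompA; apply: Lcl => //.
    have [Sj|nSj] := boolP (S (fcomp w (coface j))); first exact: add_cells_base.
    (* The face lies in the upper cell of its own pair. That cell precedes [w] by dimension or, if
       the face is the lower word, by key. *)
    have [d [v [l' [c' [r' [Ul' vE vj dm]]]]]] := missing_factor nSj.
    apply/orP; right; apply/hasP; exists (mksimplex v) => //=.
    apply: L2; first by apply/asboolP; exists l', c', r'.
    case: dm => [dm|[dm wj]]; [by left|right; split=> //].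
    have jw : j < size (word w) by rewrite size_word.
    pose a := take j (word w); pose b := drop j.+1 (word w).
    have wab : word w = a ++ nth 0 (word w) j :: b by rewrite -drop_nth // cat_take_drop.
    have sa : j = size a :> nat by rewrite size_takel // ltnW.
    rewrite /wkey /= vE wE; apply: (im_key IM Ulcr Ul') (etrans (esym wE) wab) _ _.
      by rewrite -wj (word_coface wab).
    by rewrite -sa => jl; move: ji; rewrite -val_eqE /= jl eqxx.
  apply: contraTT => nt.
  have [y|e [me te]] := mono_factor mt (coface_mono i).
    by apply: (horn_full mt nt); apply: coface_neq.
  by apply: contra nLu => Lt; rewrite /u -te -fcompA Lcl.
apply: (@rel_add_cell C W X Y f n (add_cells S L) m.+1 (horn i) w) => //.
- exact: horn_simp.
- move=> q t t' mt mt' nt e; apply: (@horn_rigid _ _ _ i w) => //.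
  + move=> x y /= ix yx; have := nth_skip c redf r0 ix.
    by rewrite -wE -yx !nth_word.
  + by rewrite hornP.
  + by rewrite hornP // -e.
- by apply: R => /=; lia.
Qed.

End Matching.

(** * From a matching to a good inclusion *)

Section MatchingRel.
Variables (n : nat) (S : subcx n) (missing : pred (seq nat)).
Variables (U : seq nat -> nat -> seq nat -> Prop) (key : seq nat -> nat).
Hypothesis Scl : face_closed S.
Hypothesis Smissing : forall m (s : {ffun 'I_m.+1 -> 'I_n.+1}), S s = ~~ missing (word s).
Hypothesis IM : inner_matching n missing U key.
Variables (C : category) (X Y : sdata C) (f : simp_map X Y).
Hypotheses (HX : is_simplicial X) (HY : is_simplicial Y) (Hf : smor X Y f).
Variable k : nat.
Hypothesis inner_iso : forall m (i : 'I_m.+1), 0 < i < m -> k < m -> cell_rel (@is_iso C) f (horn i).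

Let upper (v : simplex n) : bool :=
  `[< exists l c r, U l c r /\ word (tagged v) = l ++ c :: r >].
Let wkey (v : simplex n) := key (word (tagged v)).
Let stage q := add_cells S (cells_below upper wkey q).

Lemma rel_matching_high : relrep (@is_iso C) f (stage k.+1) (thick n).
Proof.
pose T q := stage (k.+1 + q).
have -> : stage k.+1 = T 0 by rewrite /T addn0.
apply: rel_iso_limit => //.
- move=> q; rewrite /T addn0; apply: (rel_cells_between (@stable_iso C)) => w L /andP[kw _] st.
  apply: (rel_matching_step Scl Smissing IM) st => //.
  by move=> i ii; apply: inner_iso.
- by move=> q q' qq'; apply: add_cells_mono => w; rewrite !mem_cells_below; lia.
- move=> m s _; have [Ss|nSs] := boolP (S s); first exact: add_cells_base.
  have [d [v [l [c [r [Ul vE vs dm]]]]]] := missing_factor Scl Smissing IM nSs.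
  apply/orP; right; apply/hasP; exists (mksimplex v) => //; rewrite mem_cells_below.
  apply/andP; split; first by apply/asboolP; exists l, c, r.
  by rewrite /=; case: dm => [|[-> _]]; lia.
Qed.

(** The dimension of an upper cell is the length of its lower word, so nothing is attached before
    the isomorphisms set in. *)
Lemma rel_matching_iso :
  (forall l c r, U l c r -> k < size (l ++ r)) -> relrep (@is_iso C) f S (thick n).
Proof.
move=> big; apply: (rel_eq _ _ rel_matching_high) => // q s.
rewrite /stage /add_cells; case: (boolP (S s)) => // _; rewrite orFb; apply/negbTE/hasP => -[v].
rewrite mem_cells_below => /andP[/asboolP[l [c [r [/big kl vE]]]] vk] _.
by have := size_word (tagged v); move: kl vk; rewrite vE !size_cat /=; lia.
Qed.

Lemma rel_matching (W : morclass C) : stable_class W ->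
  (forall m (i : 'I_m.+1), 0 < i < m -> cell_rel W f (horn i)) -> relrep W f S (thick n).
Proof.
move=> HW inner; apply: (rel_trans HW (T := stage k.+1)).
- exact: add_cells_base.
- by [].
- have := @rel_cells_between n S upper wkey C W HW X Y f 0 k.+1; rewrite add0n => H.
  apply: (rel_eq _ _ (H _)) => // [q s|w L _ st]; first by rewrite /add_cells /= orbF.
  by apply: (rel_matching_step Scl Smissing IM) st => // i; apply: inner.
by apply: rel_sub rel_matching_high => a b h; have [Wi _ _] := HW; apply: Wi.
Qed.

End MatchingRel.

(** * Two matchings on words *)

Lemma split_first (p : pred nat) w : has p w ->
  exists l b v, [/\ w = l ++ b :: v, p b & ~~ has p l].
Proof.
elim: w => //= c w IH; case: (boolP (p c)) => [pc _|npc /= /IH[l [b [v [-> pb nl]]]]].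
  by exists [::], c, w.
by exists (c :: l), b, v; rewrite /= negb_or npc.
Qed.

Lemma split_first_uniq (p : pred nat) l b v l' b' v' :
  p b -> ~~ has p l -> p b' -> ~~ has p l' -> l ++ b :: v = l' ++ b' :: v' ->
  [/\ l = l', b = b' & v = v'].
Proof.
elim: l l' => [|c l IH] [|c' l'] //= pb nl pb' nl' [].
- by move=> -> ->.
- by move=> e _; move: nl'; rewrite -e pb.
- by move=> e _; move: nl; rewrite e pb'.
move=> -> e; move: nl nl'; rewrite !negb_or => /andP[_ nl] /andP[_ nl'].
by have [-> -> ->] := IH _ pb nl pb' nl' e.
Qed.

Lemma cat_split (l r p : seq nat) d q : l ++ r = p ++ d :: q -> size p < size l ->
  exists q1, l = p ++ d :: q1 /\ q = q1 ++ r.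
Proof.
elim: p l => [|x p IH] [|y l] //= [-> e] lt; first by exists l.
by have [q1 [-> ->]] := IH l e lt; exists q1.
Qed.

Definition in2 (z a c : nat) : bool := (c == z) || (c == a).

Lemma in2_l z a : in2 z a z. Proof. by rewrite /in2 eqxx. Qed.
Lemma in2_r z a : in2 z a a. Proof. by rewrite /in2 eqxx orbT. Qed.

(* [l] is the longest prefix in the letters [z] and [a], [a] being the first letter other
   than [z]. *)
Definition cut (z a : nat) (l : seq nat) (b : nat) : bool :=
  [&& a != z, all (in2 z a) l, a \in l & ~~ in2 z a b].

(** The cut is found by scanning: [a] is the first letter other than [z], and [b] the first letter
    other than both. This uniqueness is what rules out conflicts between matched words. *)
Lemma cut_eq z a l b v a' l' b' v' :
  cut z a l b -> cut z a' l' b' -> l ++ b :: v = l' ++ b' :: v' ->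
  [/\ a = a', l = l', b = b' & v = v'].
Proof.
have first x k : x != z -> all (in2 z x) k -> x \in k -> exists k1 k2,
    k = k1 ++ x :: k2 /\ ~~ has (predC1 z) k1.
  move=> xz /allP kx xk; have : has (predC1 z) k by apply/hasP; exists x.
  move=> /split_first[k1 [y [k2 [e yz nk]]]]; exists k1, k2; split=> //.
  have : in2 z x y by apply: kx; rewrite e mem_cat mem_head orbT.
  by rewrite /in2 (negbTE yz) /= => /eqP <-.
move=> /and4P[az la al bl] /and4P[az' la' al' bl'] e.
have [k1 [k2 [lk nk]]] := first _ _ az la al.
have [k1' [k2' [lk' nk']]] := first _ _ az' la' al'.
have [] := @split_first_uniq (predC1 z) k1 a (k2 ++ b :: v) k1' a' (k2' ++ b' :: v') => //.
  by rewrite -!cat_cons !catA -lk -lk'.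
move=> _ aa _; subst a'.
have [] := @split_first_uniq (predC (in2 z a)) l b v l' b' v' => //.
- by rewrite has_predC la.
- by rewrite has_predC la'.
Qed.

Lemma cut_ex z w x y : x \in w -> y \in w -> x != z -> y != z -> x != y ->
  exists a l b v, w = l ++ b :: v /\ cut z a l b.
Proof.
move=> xw yw xz yz xy; have : has (predC1 z) w by apply/hasP; exists x.
move=> /split_first[l1 [a [v1 [e1 az nl1]]]].
have : has (predC (in2 z a)) w.
  have [xa|xa] := eqVneq x a; last by apply/hasP; exists x => //=; rewrite negb_or xz.
  by apply/hasP; exists y => //=; rewrite negb_or yz -xa eq_sym.
move=> /split_first[l [b [v [e /= bza]]]]; rewrite has_predC negbK => la.
exists a, l, b, v; split=> //; rewrite /cut -[a != z]/(predC1 z a) az la bza andbT /=.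
apply/contraT => al; move: bza; rewrite negb_or => /andP[bz ba].
have [||//] := @split_first_uniq (predC1 z) l1 a v1 l b v az nl1 bz; last 2 first.
- by rewrite -e1.
- by move=> _ ab; rewrite ab eqxx in ba.
rewrite has_predC negbK; apply/allP=> c cl /=; have /orP[//|/eqP ca] := allP la _ cl.
by rewrite -ca cl in al.
Qed.

Lemma cut_rcons z a l b c : cut z a l b -> in2 z a c -> cut z a (rcons l c) b.
Proof. by move=> /and4P[az la al bl] cc; rewrite /cut az all_rcons cc la mem_rcons inE al orbT. Qed.

Lemma reduced_cat x l b v : l != [::] ->
  reduced (l ++ b :: v) = [&& reduced l, last x l != b & reduced (b :: v)].
Proof. by case: l => // c l _; rewrite /reduced /= cat_path /=. Qed.

Section TypeI.
Variables (n z : nat) (Q missing : pred (seq nat)).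

(* Insert or delete [z] at the end of the longest prefix in [z] and [a]. *)
Definition matchI (l : seq nat) (c : nat) (r : seq nat) : Prop := exists a b v,
  [/\ c = z, r = b :: v, cut z a l b, last z l = a & Q v] /\
  [/\ reduced (l ++ c :: r), missing (l ++ r) & all (geq n) (l ++ c :: r)].

Lemma matchI_word l c r : matchI l c r -> [/\ l != [::], r != [::], missing (l ++ r),
    reduced (l ++ c :: r) & reduced (l ++ r)] /\ all (geq n) (l ++ c :: r).
Proof.
move=> [a [b [v [[-> -> /and4P[az la al bl] lz Qv] [red miss bnd]]]]]; split=> //.
have l0 : l != [::] by case: (l) al.
split=> //; move: red; rewrite !(reduced_cat z) // lz => /and3P[-> _ /=].
by move=> /andP[_ ->]; move: bl; rewrite negb_or eq_sym => /andP[_]; rewrite eq_sym => ->.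
Qed.

Lemma matchI_lower_upper l c r l' c' r' :
  matchI l c r -> matchI l' c' r' -> l ++ r <> l' ++ c' :: r'.
Proof.
move=> [a [b [v [[-> -> ct lz _] _]]]] [a' [b' [v' [[-> -> ct' lz' _] _]]]].
rewrite -(cat_rcons z l') => /(cut_eq ct (cut_rcons ct' (in2_l _ _)))[_ ll _ _].
by move: lz; rewrite ll last_rcons => za; move: ct => /and4P[]; rewrite za eqxx.
Qed.

Lemma matchI_lower_inj l c r l' c' r' :
  matchI l c r -> matchI l' c' r' -> l ++ r = l' ++ r' -> l ++ c :: r = l' ++ c' :: r'.
Proof.
move=> [a [b [v [[-> -> ct lz _] _]]]] [a' [b' [v' [[-> -> ct' lz' _] _]]]].
by move=> /(cut_eq ct ct')[_ -> -> ->].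
Qed.

(** Deleting a letter other than [z] lowers the count. Deleting a [z] elsewhere keeps the [z] at the
    end of the prefix, so the result is not a lower word. *)
Lemma matchI_key l c r l' c' r' p d q :
  matchI l c r -> matchI l' c' r' -> l ++ c :: r = p ++ d :: q -> l' ++ r' = p ++ q ->
  size p <> size l -> count (predC1 z) (l' ++ c' :: r') < count (predC1 z) (l ++ c :: r).
Proof.
move=> [a [b [v [[-> -> ct lz _] _]]]] [a' [b' [v' [[-> -> ct' lz' _] _]]]] e e' pl.
have [dz|dz] := eqVneq d z; last first.
  have := congr1 (count (predC1 z)) e'; have := congr1 (count (predC1 z)) e.
  by rewrite !count_cat /= eqxx dz /=; lia.
subst d; exfalso.
suff [l2 [v2 [ct2 e2]]] : exists l2 v2, cut z a l2 b /\ p ++ q = rcons l2 z ++ b :: v2.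
  move: e'; rewrite e2 => /(cut_eq ct' (cut_rcons ct2 (in2_l _ _)))[_ ll _ _].
  by move: lz'; rewrite ll last_rcons => za; move: ct' => /and4P[]; rewrite za eqxx.
have [lt|ge] := ltnP (size p) (size l).
  have [q1 [lE qE]] := cat_split e lt.
  exists (p ++ q1), v; split; last by rewrite qE cat_rcons catA.
  move: ct lz => /and4P[az la al bl]; rewrite lE last_cat /= => lz.
  rewrite /cut az bl andbT /=; apply/andP; split.
    by move: la; rewrite lE !all_cat /= => /and3P[-> _ ->].
  have : last z q1 \in z :: q1 by apply: mem_last.
  by rewrite lz inE (negbTE az) /= mem_cat => ->; rewrite orbT.
have {ge} lt : size l < size p by rewrite ltn_neqAle ge andbT; apply/eqP=> e1; apply: pl.
have [p1 [pE]] := cat_split (esym e) lt.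
case: p1 pE => [|b2 p3] pE /= [bb vE].
  by move: ct => /and4P[_ _ _]; rewrite bb in2_l.
by exists l, (p3 ++ q); split=> //; rewrite pE cat_rcons -!catA /= bb.
Qed.

(** The word is upper if its prefix ends in [z] and lower if it ends in [a]. The last hypothesis
    keeps the deletion of [z] from leading into the subcomplex. *)
Lemma matchI_total a l b v : z <= n -> cut z a l b -> Q v ->
  all (geq n) (l ++ b :: v) -> reduced (l ++ b :: v) -> missing (l ++ b :: v) ->
  (forall l0, l = rcons l0 z -> missing (l0 ++ b :: v)) ->
  exists l' c r, matchI l' c r /\ (l ++ b :: v = l' ++ c :: r \/ l ++ b :: v = l' ++ r).
Proof.
move=> zn ct Qv bnd red miss missl; have /and4P[az la al bl] := ct.
case/lastP: l ct la al bnd red miss missl => // l x ct la al bnd red miss missl.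
move: la; rewrite all_rcons => /andP[/orP[/eqP xz|/eqP xa] la].
  subst x; exists l, z, (b :: v); split; last by left; rewrite cat_rcons.
  move: al; rewrite mem_rcons inE (negbTE az) /= => al.
  rewrite cat_rcons in bnd red miss *; exists a, b, v; split; split=> //.
  - by rewrite /cut az la al.
  - have l0 : l != [::] by case: (l) al.
    move: red; rewrite (reduced_cat z) // => /and3P[_ lz _].
    have : last z l \in l by case: (l) l0 => // y k _; apply: mem_last.
    by move=> /(allP la) /orP[/eqP e|/eqP //]; move: lz; rewrite e eqxx.
  - exact: missl.
exists (rcons l x), z, (b :: v); split; last by right.
exists a, b, v; split; split=> //; first by rewrite last_rcons.
- have l0 : rcons l x != [::] by case: (l).
  move: red; rewrite !(reduced_cat z) // last_rcons xa az => /and3P[-> _ rb] /=.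
  move: bl; rewrite negb_or eq_sym => /andP[zb _].
  by move: rb; rewrite /reduced /= zb.
- by move: bnd; rewrite !all_cat /= zn.
Qed.

End TypeI.

Definition full n (w : seq nat) : bool := all (mem w) (iota 0 n.+1).
Definition full_but n z (w : seq nat) : bool := all (fun j => (j == z) || (j \in w)) (iota 0 n.+1).

Lemma fullP n w : reflect (forall j, j <= n -> j \in w) (full n w).
Proof.
apply: (iffP allP) => H j; first by move=> jn; apply: H; rewrite mem_iota.
by rewrite mem_iota /= add0n ltnS; apply: H.
Qed.

Lemma full_butP n z w : reflect (forall j, j <= n -> j != z -> j \in w) (full_but n z w).
Proof.
apply: (iffP allP) => H j.
  move=> jn jz; have := H j; rewrite mem_iota /= add0n ltnS jn (negbTE jz); exact.
by rewrite mem_iota /= add0n ltnS => jn; case: eqVneq => //= jz; apply: H.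
Qed.

Lemma two_other_letters n z : 1 < n -> exists x y, [/\ x <= n, y <= n, x != z, y != z & x != y].
Proof.
move=> n1; case: z => [|[|z]]; first by exists 1, 2; split=> //; lia.
  by exists 0, 2; split=> //; lia.
by exists 0, 1; split=> //; lia.
Qed.

(** Inserting or deleting [z] does not affect the presence of the other letters, so the pairs stay
    outside the thick horn. Two letters other than [z] make the scan stop inside the word, which
    keeps the face inner. *)
Lemma thick_horn_matching n z : 1 < n -> z <= n ->
  inner_matching n (full_but n z) (matchI n z xpredT (full_but n z)) (count (predC1 z)).
Proof.
move=> n1 zn; split.
- by move=> l c r; apply: matchI_word.
- move=> w miss red bnd.
  have [x [y [xn yn xz yz xy]]] := two_other_letters z n1.
  have /full_butP fw := miss.
  have [a [l [b [v [e ct]]]]] := cut_ex (fw _ xn xz) (fw _ yn yz) xz yz xy.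
  rewrite e in red bnd miss *; apply: (matchI_total zn ct) => // l0 ll.
  apply/full_butP=> j jn jz; have /full_butP/(_ _ jn jz) := miss.
  by rewrite ll cat_rcons !mem_cat !inE (negbTE jz).
- by move=> l c r l' c' r'; apply: matchI_lower_upper.
- by move=> l c r l' c' r'; apply: matchI_lower_inj.
- by move=> l c r l' c' r' p d q; apply: matchI_key.
Qed.

Lemma thick_horn_matching_size n z l c r : matchI n z xpredT (full_but n z) l c r ->
  z <= n -> n <= size (l ++ r).
Proof.
move=> /matchI_word[[_ _ /full_butP fw _ _] _] zn.
have : {subset rem z (iota 0 n.+1) <= l ++ r}.
  move=> j; rewrite mem_rem_uniq ?iota_uniq // inE mem_iota /= add0n ltnS => /andP[jz jn].
  exact: fw.
move=> /uniq_leq_size; rewrite rem_uniq ?iota_uniq // => /(_ isT).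
by rewrite size_rem ?size_iota // mem_iota.
Qed.

(** * The matching relative to the thick boundary and the ordinary simplex *)

Section SpineMatching.
Variable n : nat.
Hypothesis n1 : 1 < n.

Let M (w : seq nat) : bool := full n w && ~~ sorted leq w.

(* The words [0 y] with [0] not in [y]: after the longest prefix [0 1 .. j] whose letters do not
   recur, insert or delete [j+1]. *)
Definition match0 (l : seq nat) (c : nat) (r : seq nat) : Prop := exists j,
  [/\ l = iota 0 j.+1, c = j.+1, all (ltn j) r, c \in r & head 0 r != c] /\
  [/\ reduced (l ++ c :: r), M (l ++ r) & all (geq n) (l ++ c :: r)].

(* The words [l b v] with [0] not in [v] and a [0] in [l] behind the first letter: insert or
   delete [a] at the end of [l]. *)
Definition matchII (l : seq nat) (c : nat) (r : seq nat) : Prop := exists b v,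
  [/\ r = b :: v, cut 0 c l b, last c l = 0 & 0 \notin v] /\
  [/\ reduced (l ++ c :: r), M (l ++ r) & all (geq n) (l ++ c :: r)].

(** Deleting a 0 must leave a full word, hence the restriction to words with a further 0 in the
    tail. That 0 stands behind [a], so the shorter word is not monotone either. *)
Definition matchI0 := matchI n 0 (fun v => 0 \in v) M.

Definition spine_match l c r : Prop := [\/ match0 l c r, matchII l c r | matchI0 l c r].

(** On upper words the key is at most [n] for [match0], equal to [n.+1] for [matchII], and at least
    [n.+2] for [matchI0]; an unmatched face of an upper word is never the lower word of a later
    kind. In the last branch [find] yields the first repeated letter, for [match0] the inserted
    [j.+1], so that longer prefixes come first. *)
Definition spine_key (w : seq nat) : nat :=
  if `[< exists l c r, matchI0 l c r /\ w = l ++ c :: r >] then n.+2 + count (predC1 0) w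
  else if 0 \in behead w then n.+1
  else n - find (fun c => 1 < count_mem c w) (iota 0 n.+1).

Lemma not_sorted_cat l b v (x y : nat) :
  x \in l -> y \in b :: v -> y < x -> ~~ sorted leq (l ++ b :: v).
Proof.
move=> xl yv yx; apply/negP; rewrite (sorted_pairwise leq_trans) pairwise_cat => /and3P[/allrelP H _ _].
by have := H _ _ xl yv; rewrite leqNgt yx.
Qed.

Lemma match0_zero l c r : match0 l c r -> 0 \notin behead (l ++ r) /\ 0 \notin behead (l ++ c :: r).
Proof.
move=> [j [[-> -> rj _ _] _]].
have r0 : 0 \notin r by apply/negP=> /(allP rj).
by rewrite /= !mem_cat !inE mem_iota /= (negbTE r0).
Qed.

Lemma matchII_zero l c r : matchII l c r -> 0 \in behead (l ++ r) /\ 0 \in behead (l ++ c :: r).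
Proof.
move=> [b [v [[-> /and4P[c0 lc cl bl] lz v0] _]]].
suff : 0 \in behead l by case: (l) => //= x k; rewrite !mem_cat => ->.
case: l lc cl lz => // x [|y l] lc cl lz.
  by move: cl c0; rewrite inE => /eqP ->; move: lz => /= ->.
by have := mem_last y l; rewrite /= in lz *; rewrite lz.
Qed.

Lemma matchI0_zero l c r : matchI0 l c r -> 0 \in behead (l ++ r) /\ 0 \in behead (l ++ c :: r).
Proof.
move=> [a [b [v [[-> -> /and4P[_ _ al _] _ v0] _]]]].
by case: l al => // x l _; rewrite /= !mem_cat !inE v0 !orbT.
Qed.

(** Both kinds insert at the end of the prefix of a cut for 0, which leaves the tail alone; whether
    0 occurs in the tail tells them apart. *)
Lemma matchI0_II l c r l' c' r' : matchI0 l c r -> matchII l' c' r' ->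
  [/\ l ++ r <> l' ++ r', l ++ r <> l' ++ c' :: r', l ++ c :: r <> l' ++ r'
    & l ++ c :: r <> l' ++ c' :: r'].
Proof.
move=> [a [b [v [[-> -> ct _ v0] _]]]] [b' [v' [[-> ct' _ v0'] _]]].
have ct1 := cut_rcons ct (in2_l 0 a); have ct1' := cut_rcons ct' (in2_r 0 c').
rewrite -!(cat_rcons _ l) -!(cat_rcons _ l').
split=> e; rewrite ?cat_rcons in e.
- by have [_ _ _ vv] := cut_eq ct ct' e; move: v0; rewrite vv (negbTE v0').
- rewrite -(cat_rcons c' l') in e.
  by have [_ _ _ vv] := cut_eq ct ct1' e; move: v0; rewrite vv (negbTE v0').
- rewrite -(cat_rcons 0 l) in e.
  by have [_ _ _ vv] := cut_eq ct1 ct' e; move: v0; rewrite vv (negbTE v0').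
- rewrite -(cat_rcons 0 l) -(cat_rcons c' l') in e.
  by have [_ _ _ vv] := cut_eq ct1 ct1' e; move: v0; rewrite vv (negbTE v0').
Qed.

Lemma keyI l c r : matchI0 l c r -> spine_key (l ++ c :: r) = n.+2 + count (predC1 0) (l ++ c :: r).
Proof. by move=> m; rewrite /spine_key asboolT //; exists l, c, r. Qed.

Lemma keyII l c r : matchII l c r -> spine_key (l ++ c :: r) = n.+1.
Proof.
move=> m; rewrite /spine_key asboolF; first by rewrite (matchII_zero m).2.
by move=> [l' [c' [r' [m' e]]]]; have [_ _ _] := matchI0_II m' m; rewrite e.
Qed.

Lemma count_prefix j c r i : all (ltn j) r -> c = j.+1 -> i <= j ->
  count_mem i (iota 0 j.+1 ++ c :: r) = 1 /\ count_mem i (iota 0 j.+1 ++ r) = 1.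
Proof.
move=> rj -> ij.
have ci : count_mem i (iota 0 j.+1) = 1 by rewrite count_uniq_mem ?iota_uniq // mem_iota add0n ltnS ij.
have cr : count_mem i r = 0 by apply/count_memPn/negP=> /(allP rj) /=; rewrite ltnNge ij.
have cj : (j.+1 == i) = false by rewrite gtn_eqF.
by rewrite !count_cat ci [count_mem i (_ :: _)]/= cr cj.
Qed.

Lemma key0 j c r : match0 (iota 0 j.+1) c r -> spine_key (iota 0 j.+1 ++ c :: r) = n - j.+1 /\ j < n.
Proof.
move=> m; have [_ z2] := match0_zero m; rewrite /spine_key asboolF; last first.
  by move=> [l' [c' [r' [m' e]]]]; have [_] := matchI0_zero m'; rewrite -e (negbTE z2).
rewrite (negbTE z2); have [j' [[e ec rj cr hr] [_ _ bnd]]] := m.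
have {e} ej : j' = j by have := congr1 size e; rewrite !size_iota => -[].
subst j' c; have jn : j < n.
  by have /allP/(_ j.+1) := bnd; rewrite mem_cat mem_head orbT; apply.
split=> //; congr (n - _).
have -> : iota 0 n.+1 = iota 0 j.+1 ++ iota j.+1 (n - j) by rewrite -iotaD; congr iota; lia.
rewrite find_cat size_iota; case: hasP => [[i]|_].
  by rewrite mem_iota add0n ltnS => /andP[_ ij]; rewrite (count_prefix rj erefl ij).1.
have c2 : 1 < count_mem j.+1 (iota 0 j.+1 ++ j.+1 :: r).
  rewrite count_cat; have -> : count_mem j.+1 (j.+1 :: r) = 1 + count_mem j.+1 r by rewrite /= eqxx.
  have : 0 < count_mem j.+1 r by rewrite -has_count has_pred1.
  by lia.
have -> : n - j = (n - j.+1).+1 by lia.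
by rewrite [find _ (iota _ _)]/= c2 addn0.
Qed.

Lemma spine_match_word l c r : spine_match l c r -> [/\ l != [::], r != [::], M (l ++ r),
    reduced (l ++ c :: r) & reduced (l ++ r)] /\ all (geq n) (l ++ c :: r).
Proof.
case=> [[j [[-> -> rj cr hr] [red Mlr bnd]]]|[b [v [[-> ct lz v0] [red Mlr bnd]]]]|].
- split=> //; split=> //; first by case: (r) cr.
  move: red; case: r rj cr hr {Mlr bnd} => // b r rj cr hr.
  rewrite !(reduced_cat 0) // => /and3P[-> _ /=] /andP[_ ->].
  rewrite andbT /=; have -> : last 0 (iota 1 j) = j.
    by case: (j) => // i; rewrite -nth_last size_iota nth_iota.
  by move: rj => /= /andP[/ltn_eqF -> _].
- have /and4P[_ _ cl bl] := ct; have l0 : l != [::] by case: (l) cl.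
  split=> //; split=> //; move: red; rewrite !(reduced_cat c) // lz => /and3P[-> _ /= /andP[_ ->]].
  by move: bl; rewrite negb_or eq_sym => /andP[-> _].
- exact: matchI_word.
Qed.

Lemma nth_prefix j (r : seq nat) i : i <= j -> nth 0 (iota 0 j.+1 ++ r) i = i.
Proof. by move=> ij; rewrite nth_cat size_iota ltnS ij nth_iota. Qed.

Lemma nth_after_prefix j (r : seq nat) : nth 0 (iota 0 j.+1 ++ r) j.+1 = head 0 r.
Proof. by rewrite nth_cat size_iota ltnn subnn nth0. Qed.

Lemma prefix_rcons j (r : seq nat) : iota 0 j.+1 ++ j.+1 :: r = iota 0 j.+2 ++ r.
Proof. by rewrite -[j.+2]addn1 iotaD -catA. Qed.

Lemma match0_lower_upper l c r l' c' r' : match0 l c r -> match0 l' c' r' ->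
  l ++ r <> l' ++ c' :: r'.
Proof.
move=> [j [[-> -> rj cr hr] _]] [j' [[-> -> rj' cr' hr'] _]] e.
have [jj|jj] := leqP j j'.
  have := congr1 (nth 0 ^~ j.+1) e; rewrite nth_after_prefix => hj; move: hr; rewrite hj.
  by rewrite prefix_rcons nth_prefix ?ltnS // eqxx.
have := congr1 (count_mem j'.+1) e; rewrite (count_prefix rj erefl jj).2 count_cat.
have -> : count_mem j'.+1 (j'.+1 :: r') = 1 + count_mem j'.+1 r' by rewrite /= eqxx.
have : 0 < count_mem j'.+1 r' by rewrite -has_count has_pred1.
by lia.
Qed.

Lemma match0_lower_inj l c r l' c' r' : match0 l c r -> match0 l' c' r' ->
  l ++ r = l' ++ r' -> l ++ c :: r = l' ++ c' :: r'.
Proof.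
move=> [j [[-> -> rj cr hr] _]] [j' [[-> -> rj' cr' hr'] _]] e.
have nlt i i' k k' : head 0 k != i.+1 -> iota 0 i.+1 ++ k = iota 0 i'.+1 ++ k' -> ~~ (i < i').
  move=> hk ek; apply/negP=> ii; have := congr1 (nth 0 ^~ i.+1) ek.
  by rewrite nth_after_prefix nth_prefix // => hi; move: hk; rewrite hi eqxx.
have jj : j = j'.
  by apply/eqP; rewrite eqn_leq (leqNgt j) (leqNgt j') (nlt _ _ _ _ hr e) (nlt _ _ _ _ hr' (esym e)).
by subst j'; move/eqP: e; rewrite eqseq_cat // eqxx => /eqP ->.
Qed.

Lemma matchII_lower_upper l c r l' c' r' : matchII l c r -> matchII l' c' r' ->
  l ++ r <> l' ++ c' :: r'.
Proof.
move=> [b [v [[-> ct lz _] _]]] [b' [v' [[-> ct' lz' _] _]]].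
rewrite -(cat_rcons c' l') => /(cut_eq ct (cut_rcons ct' (in2_r _ _)))[_ ll _ _].
by move: lz; rewrite ll last_rcons => c0; move: ct' => /and4P[]; rewrite c0.
Qed.

Lemma matchII_lower_inj l c r l' c' r' : matchII l c r -> matchII l' c' r' ->
  l ++ r = l' ++ r' -> l ++ c :: r = l' ++ c' :: r'.
Proof.
move=> [b [v [[-> ct lz _] _]]] [b' [v' [[-> ct' lz' _] _]]].
by move=> /(cut_eq ct ct')[-> -> -> ->].
Qed.

(** The letters 0 .. j occur once, so a face omitting one of them is not full. A deletion behind the
    inserted [j.+1] leaves 0 .. j+1 in front, and a lower word beginning like that has a longer
    prefix, hence a smaller key. *)
Lemma match0_key l c r l' c' r' p d q : match0 l c r -> match0 l' c' r' ->
  l ++ c :: r = p ++ d :: q -> l' ++ r' = p ++ q -> size p <> size l ->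
  spine_key (l' ++ c' :: r') < spine_key (l ++ c :: r).
Proof.
move=> m m'; have [j [[lE cE rj cr hr] _]] := m; have [j' [[lE' cE' rj' cr' hr'] [_ Ml _]]] := m'.
subst l c l' c'; have [-> jn] := key0 m; have [-> jn'] := key0 m' => e e' pl.
suff : j < j' by lia.
rewrite size_iota in pl; have {pl} [pj|pj] : size p <= j \/ j.+1 < size p by lia.
  have dE : d = size p.
    have := congr1 (nth 0 ^~ (size p)) e; rewrite nth_prefix //.
    by rewrite nth_cat ltnn subnn.
  have := (count_prefix rj erefl pj).1; rewrite e count_cat dE.
  have -> : count_mem (size p) (size p :: q) = 1 + count_mem (size p) q by rewrite /= eqxx.
  have : 0 < count_mem (size p) (p ++ q).
    rewrite -has_count has_pred1 -e'; have /andP[/fullP fw _] := Ml; apply: fw.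
    by apply: leq_trans pj (ltnW jn).
  by rewrite count_cat; lia.
have [|p1 [pE rE]] := cat_split (esym e); first by rewrite size_iota.
rewrite ltnNge; apply/negP=> jj; have := congr1 (nth 0 ^~ j'.+1) e'; rewrite nth_after_prefix.
by rewrite pE prefix_rcons -catA nth_prefix ?ltnS // => hj; move: hr'; rewrite hj eqxx.
Qed.

(** The face still has the inserted [c] at the end of its prefix and no 0 in its tail. A lower word
    of [matchII] has 0 at the end of the prefix, and one of [matchI0] has a 0 in the tail. *)
Lemma matchII_face l c r l' b' v' a' p d q : matchII l c r ->
  l ++ c :: r = p ++ d :: q -> l' ++ b' :: v' = p ++ q -> size p <> size l ->
  full n (p ++ q) -> reduced (p ++ q) -> cut 0 a' l' b' -> 0 \notin v' /\ last 0 l' != 0.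
Proof.
move=> [b [v [[-> ct lz v0] _]]] e e' pl fu red ct'.
suff [l2 [b2 [v2 [ct2 e2 z2]]]] : exists l2 b2 v2,
    [/\ cut 0 c (rcons l2 c) b2, p ++ q = rcons l2 c ++ b2 :: v2 & 0 \notin v2].
  move: e'; rewrite e2 => /(cut_eq ct' ct2)[_ -> _ ->]; rewrite last_rcons; split=> //.
  by have /and4P[] := ct.
have /and4P[c0 lc cl bl] := ct.
have [lt|ge] := ltnP (size p) (size l).
  have [q1 [lE qE]] := cat_split e lt.
  exists (p ++ q1), b, v; split=> //; last by rewrite qE cat_rcons catA.
  rewrite /cut c0 bl mem_rcons mem_head all_rcons in2_r !andbT /=.
  by move: lc; rewrite lE !all_cat /= => /and3P[-> _ ->].
have {ge} lt : size l < size p by rewrite ltn_neqAle ge andbT; apply/eqP=> e1; apply: pl.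
have [p1 [pE rE]] := cat_split (esym e) lt.
have y0 : 0 \notin p1 ++ q.
  have : 0 \notin b :: v by have /norP[b0 _] := bl; rewrite inE negb_or v0 eq_sym b0.
  by rewrite rE !mem_cat inE !negb_or => /and3P[-> _ ->].
(* The deleted letter may be [b]. A letter other than 0 and [c] shows that the tail is not
   exhausted; its first letter is not 0 and, the face being reduced, not [c], so the prefix does not
   grow. *)
have [x [y [xn yn x0 y0' xy]]] := two_other_letters 0 n1.
have [z [zn z0 zc]] : exists z, [/\ z <= n, z != 0 & z != c].
  have [xc|xc] := eqVneq x c; last by exists x.
  by exists y; split=> //; rewrite -xc eq_sym.
have : z \in p ++ q by move/fullP: fu; apply.
move: red; rewrite pE -catA [(c :: p1) ++ q]/= -cat_rcons => red.
rewrite mem_cat mem_rcons inE (negbTE zc) /= => /orP[zl|].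
  by have := allP lc _ zl; rewrite /in2 (negbTE z0) (negbTE zc).
case: (p1 ++ q) y0 red => // b2 v2 y0 red _; exists l, b2, v2; split=> //.
  apply/and4P; split=> //; rewrite ?mem_rcons ?mem_head // ?all_rcons ?in2_r //.
  move: y0; rewrite inE negb_or eq_sym => /andP[b0 _]; rewrite /in2 negb_or b0 /=.
  move: red; rewrite (reduced_cat 0) ?last_rcons => [/and3P[_ + _]|]; first by rewrite eq_sym.
  by case: (l).
by move: y0; rewrite inE negb_or => /andP[].
Qed.

Lemma spine_match_key l c r l' c' r' p d q : spine_match l c r -> spine_match l' c' r' ->
  l ++ c :: r = p ++ d :: q -> l' ++ r' = p ++ q -> size p <> size l ->
  spine_key (l' ++ c' :: r') < spine_key (l ++ c :: r).
Proof.
move=> m m' e e' pl.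
have [[_ _ /andP[fu _] _ red] _] := spine_match_word m'; rewrite e' in fu red.
case: m' => m'.
- case: m => m; first exact: match0_key e e' pl.
    have [j [[lE' cE' _ _ _] _]] := m'; subst l'.
    by rewrite (keyII m) (key0 m').1; lia.
  have [j [[lE' cE' _ _ _] _]] := m'; subst l'.
  by rewrite (keyI m) (key0 m').1; lia.
- case: m => m.
  + have [z1 _] := matchII_zero m'; have [_ z2] := match0_zero m; exfalso.
    move: z1 z2; rewrite e' e; case: (p) => [|x k] /=.
      by move=> z1; case: (q) z1 => //= y k z1; rewrite inE z1 orbT.
    by rewrite !mem_cat inE; case/orP=> ->; rewrite ?orbT.
  + have [b' [v' [[rE' ct' lz' v0'] _]]] := m'; rewrite rE' in e'.
    have [_] := matchII_face m e e' pl fu red ct'.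
    have /and4P[_ _ cl' _] := ct'.
    by case: (l') cl' lz' => // x k _ /= ->.
  + by rewrite (keyII m') (keyI m); lia.
- case: m => m.
  + have [z1 _] := matchI0_zero m'; have [_ z2] := match0_zero m; exfalso.
    move: z1 z2; rewrite e' e; case: (p) => [|x k] /=.
      by move=> z1; case: (q) z1 => //= y k z1; rewrite inE z1 orbT.
    by rewrite !mem_cat inE; case/orP=> ->; rewrite ?orbT.
  + have [a' [b' [v' [[_ rE' ct' lz' v0'] _]]]] := m'; rewrite rE' in e'.
    by have [] := matchII_face m e e' pl fu red ct'; rewrite v0'.
  + by rewrite (keyI m) (keyI m') ltn_add2l; exact: (matchI_key m m' e e' pl).
Qed.

Lemma last_prefix j : last 0 (iota 0 j.+1) = j.
Proof. by rewrite -nth_last size_iota nth_iota. Qed.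

(** A next letter other than [j.+1] makes the word lower, a [j.+1] that recurs makes it upper, and
    one that does not recur lengthens the prefix. The last case cannot go on forever: the word would
    become 0 .. n, which is monotone. *)
Lemma match0_total j r : all (ltn j) r -> M (iota 0 j.+1 ++ r) -> reduced (iota 0 j.+1 ++ r) ->
  all (geq n) (iota 0 j.+1 ++ r) ->
  exists l' c' r', match0 l' c' r' /\
    (iota 0 j.+1 ++ r = l' ++ c' :: r' \/ iota 0 j.+1 ++ r = l' ++ r').
Proof.
elim: {j}(n - j) {-2}j (erefl (n - j)) r => [|k IH] j nj r rj Mw red bnd.
  have r0 : r = [::].
    case: r rj bnd {Mw red} => // b r /= /andP[jb _]; rewrite all_cat => /andP[_] /= /andP[bn _].
    by exfalso; move: jb bn nj; rewrite /=; lia.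
  by move: Mw; rewrite r0 cats0 /M iota_sorted andbF.
have jn : j < n by lia.
have jr : j.+1 \in r.
  have /andP[/fullP/(_ _ jn) + _] := Mw; rewrite mem_cat mem_iota add0n ltnn; exact.
case: r rj Mw red bnd jr => // b r rj Mw red bnd jr.
have [bj|bj] := eqVneq b j.+1; last first.
  exists (iota 0 j.+1), j.+1, (b :: r); split; last by right.
  exists j; split; split=> //.
    move: red; rewrite !(reduced_cat 0) // last_prefix => /and3P[-> _ rb].
    by move: rb; rewrite /reduced /= => ->; rewrite (eq_sym j.+1) bj /= neq_ltn ltnSn.
  by move: bnd; rewrite !all_cat /= jn.
subst b; have [jr2|jr2] := boolP (j.+1 \in r).
  exists (iota 0 j.+1), j.+1, r; split; last by left.
  have /andP[_ rj2] : all (ltn j) (j.+1 :: r) by [].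
  have hr : head 0 r != j.+1.
    move: red; rewrite (reduced_cat 0) // => /and3P[_ _]; case: (r) jr2 => // b' r'.
    by rewrite /reduced /= eq_sym => _ /andP[].
  exists j; split; split=> //; apply/andP; split.
    apply/fullP=> i ij; have /andP[/fullP/(_ _ ij) + _] := Mw.
    by rewrite !mem_cat (in_cons _ r) => /or3P[-> //|/eqP ->|->]; rewrite ?jr2 orbT.
  case: r jr2 hr rj2 {rj Mw red bnd jr} => // b' r' jr2 hr /andP[jb _]; rewrite [head _ _]/= in hr.
  move: jr2; rewrite inE eq_sym (negbTE hr) /= => jr2.
  rewrite -cat_rcons; case: r' jr2 => // b2 r2 jr2.
  rewrite -[path _ _ _]/(sorted leq (rcons (iota 0 j.+1) b' ++ b2 :: r2)).
  apply: (not_sorted_cat (x := b') (y := j.+1)) => //; first by rewrite mem_rcons mem_head.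
  by rewrite ltn_neqAle eq_sym hr.
rewrite prefix_rcons in Mw red bnd *; apply: IH => //; first by lia.
apply/allP=> i ir; have /andP[_ /allP/(_ _ ir) /= ji] : all (ltn j) (j.+1 :: r) by [].
by rewrite /= ltn_neqAle ji andbT; apply: contraNneq jr2 => ->.
Qed.

(** The prefix alternates between 0 and [a], and the word is lower if it ends in 0. If it ends in
    [a], the 0 behind the first letter forces an earlier [a]; deleting the last one keeps the word
    full, and the earlier one, standing before a 0, keeps it from being monotone. *)
Lemma matchII_total a l b v : cut 0 a l b -> 0 \notin v -> 0 \in behead (l ++ b :: v) ->
  all (geq n) (l ++ b :: v) -> reduced (l ++ b :: v) -> M (l ++ b :: v) ->
  exists l' c r, matchII l' c r /\ (l ++ b :: v = l' ++ c :: r \/ l ++ b :: v = l' ++ r).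
Proof.
move=> ct v0 bz bnd red Mw; have /and4P[a0 la al bl] := ct; have /norP[b0 ba] := bl.
case/lastP: l ct la al bz bnd red Mw => // l x ct la al bz bnd red Mw.
have lx0 : rcons l x != [::] by case: (l).
move: la; rewrite all_rcons => /andP[/orP[/eqP x0|/eqP xa] la].
  subst x; exists (rcons l 0), a, (b :: v); split; last by right.
  exists b, v; split; split=> //; first by rewrite last_rcons.
    move: red; rewrite !(reduced_cat 0) // !last_rcons (eq_sym 0 a) a0 => /and3P[-> _ rb] /=.
    by move: rb; rewrite /reduced /= (eq_sym a) ba.
  move: bnd; rewrite !all_cat /= => /andP[lb ->]; rewrite lb /= andbT.
  exact: (allP lb _ al).
subst x; exists l, a, (b :: v); split; last by left; rewrite cat_rcons.
rewrite cat_rcons in bz bnd red Mw *.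
have [y [k [lE k0]]] : exists y k, l = y :: k /\ 0 \in k.
  case: (l) bz => /= [|y k]; first by rewrite inE eq_sym (negbTE b0) (negbTE v0).
  rewrite mem_cat !inE eq_sym (negbTE a0) eq_sym (negbTE b0) (negbTE v0) /= orbF => k0.
  by exists y, k.
have l0 : l != [::] by rewrite lE.
move: (red); rewrite (reduced_cat a) // => /and3P[rl lla _].
have all2 : a \in l.
  move: rl la; rewrite lE /= => rl /andP[/orP[/eqP y0|/eqP ya] kk]; last by rewrite ya mem_head.
  case: k k0 rl kk {lE} => // h k _; rewrite /reduced /= => /andP[yh _] /andP[/orP[/eqP h0|/eqP ha] _].
    by move: yh; rewrite y0 h0.
  by rewrite ha !inE eqxx orbT.
have ll0 : last a l = 0.
  have : last a l \in l by rewrite lE; apply: mem_last.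
  by move=> /(allP la) /orP[/eqP //|/eqP e]; move: lla; rewrite e eqxx.
exists b, v; split; split=> //; first by rewrite /cut a0 la all2.
apply/andP; split.
  apply/fullP=> i ij; have /andP[/fullP/(_ _ ij) + _] := Mw.
  by rewrite !mem_cat inE => /or3P[-> //|/eqP ->|->]; rewrite ?all2 ?orbT.
case/lastP: (l) all2 ll0 => // l1 x; rewrite last_rcons mem_rcons inE => al1 x0.
rewrite cat_rcons; apply: (not_sorted_cat (x := a) (y := 0)); last by rewrite lt0n.
  by move: al1; rewrite x0 (negbTE a0).
by rewrite x0 mem_head.
Qed.

Lemma spine_matching : inner_matching n M spine_match spine_key.
Proof.
split.
- exact: spine_match_word.
- move=> w Mw red bnd; have /andP[/fullP fw _] := Mw.
  have [bz|bz] := boolP (0 \in behead w); last first.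
    case: w Mw red bnd fw bz => [|x w] Mw red bnd fw bz; first by have := fw 0.
    have x0 : x = 0.
      by have := fw 0 (leq0n _); rewrite inE (negbTE bz) orbF => /eqP.
    subst x; have [|//|//|//|l [c [r [m e]]]] := @match0_total 0 w.
      by apply/allP=> i iw /=; rewrite lt0n; apply: contraNneq bz => <-.
    by exists l, c, r; split=> //; apply: Or31.
  have [x [y [xn yn xz yz xy]]] := two_other_letters 0 n1.
  have [a [l [b [v [e ct]]]]] := cut_ex (fw _ xn) (fw _ yn) xz yz xy.
  have /and4P[a0 la al bl] := ct.
  subst w; have [v0|v0] := boolP (0 \in v).
    have [|l' [c' [r' [m e']]]] := @matchI_total n 0 (fun v => 0 \in v) M a l b v (leq0n n) ct v0 bnd red Mw.
      move=> l0 lE; apply/andP; split.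
        apply/fullP=> i ij; have := fw _ ij.
        rewrite lE cat_rcons !mem_cat inE => /or3P[-> //|/eqP ->|->]; last by rewrite orbT.
        by rewrite inE v0 !orbT.
      apply: (not_sorted_cat (x := a) (y := 0)); last by rewrite lt0n.
        by move: al; rewrite lE mem_rcons inE (negbTE a0).
      by rewrite inE v0 orbT.
    by exists l', c', r'; split=> //; apply: Or33.
  have [l' [c' [r' [m e']]]] := matchII_total ct v0 bz bnd red Mw.
  by exists l', c', r'; split=> //; apply: Or32.
- move=> l c r l' c' r' [] m [] m' e.
  + exact: match0_lower_upper m m' e.
  + by have [z _] := match0_zero m; move: z; rewrite e (matchII_zero m').2.
  + by have [z _] := match0_zero m; move: z; rewrite e (matchI0_zero m').2.
  + by have [z _] := matchII_zero m; move: z; rewrite e (negbTE (match0_zero m').2).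
  + exact: matchII_lower_upper m m' e.
  + by have [_ _ H _] := matchI0_II m' m; apply: H.
  + by have [z _] := matchI0_zero m; move: z; rewrite e (negbTE (match0_zero m').2).
  + by have [_ H _ _] := matchI0_II m m'; apply: H.
  + exact: (matchI_lower_upper m m' e).
- move=> l c r l' c' r' [] m [] m' e.
  + exact: match0_lower_inj m m' e.
  + by have [z _] := match0_zero m; move: z; rewrite e (matchII_zero m').1.
  + by have [z _] := match0_zero m; move: z; rewrite e (matchI0_zero m').1.
  + by have [z _] := matchII_zero m; move: z; rewrite e (negbTE (match0_zero m').1).
  + exact: matchII_lower_inj m m' e.
  + by have [H _ _ _] := matchI0_II m' m; case: H.
  + by have [z _] := matchI0_zero m; move: z; rewrite e (negbTE (match0_zero m').1).
  + by have [H _ _ _] := matchI0_II m m'; case: H.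
  + exact: (matchI_lower_inj m m' e).
- exact: spine_match_key.
Qed.

End SpineMatching.

(** * The simplicial spaces of thick simplices *)

Definition thick_horn n (z : 'I_n.+1) : subcx n :=
  fun m s => [exists j : 'I_n.+1, (j != z) && [forall l, s l != j]].
Definition thick_bdry n : subcx n := fun m s => [exists j : 'I_n.+1, [forall l, s l != j]].
(** Not the path of consecutive edges that usually bears this name. *)
Definition spine n : subcx n := fun m s => mono s || thick_bdry s.

Lemma thick_horn_comp n z m m' s (t : {ffun 'I_m'.+1 -> 'I_m.+1}) :
  @thick_horn n z m s -> @thick_horn n z m' (fcomp s t).
Proof.
move=> /existsP[j /andP[jz /forallP sj]]; apply/existsP; exists j; rewrite jz.
by apply/forallP=> x; rewrite fcompE.
Qed.

Lemma thick_bdry_comp n m m' s (t : {ffun 'I_m'.+1 -> 'I_m.+1}) :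
  @thick_bdry n m s -> @thick_bdry n m' (fcomp s t).
Proof.
move=> /existsP[j /forallP sj]; apply/existsP; exists j.
by apply/forallP=> x; rewrite fcompE.
Qed.

Lemma spine_closed n : face_closed (@spine n).
Proof.
move=> m m' s t /orP[ms|bs] mt; apply/orP; [left|right]; first exact: mono_fcomp.
exact: thick_bdry_comp.
Qed.

Lemma missed_letter m n (s : {ffun 'I_m.+1 -> 'I_n.+1}) (j : 'I_n.+1) :
  [forall l, s l != j] = (nat_of_ord j \notin word s).
Proof. by rewrite mem_word negb_exists. Qed.

Lemma thick_horn_word m n (z : 'I_n.+1) (s : {ffun 'I_m.+1 -> 'I_n.+1}) :
  thick_horn z s = ~~ full_but n z (word s).
Proof.
apply/existsP/idP => [[j /andP[jz]]|].
  rewrite missed_letter; apply: contra => /full_butP; apply=> //.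
  by rewrite -ltnS.
move=> nf; apply: contrapT => no; move/negP: nf; apply; apply/full_butP => j jn jz.
apply/negPn/negP=> js; apply: no; rewrite -ltnS in jn; exists (Ordinal jn).
by rewrite missed_letter js andbT -val_eqE.
Qed.

Lemma thick_bdry_word m n (s : {ffun 'I_m.+1 -> 'I_n.+1}) : thick_bdry s = ~~ full n (word s).
Proof.
apply/existsP/idP => [[j]|].
  by rewrite missed_letter; apply: contra => /fullP; apply; rewrite -ltnS.
move=> nf; apply: contrapT => no; move/negP: nf; apply; apply/fullP => j jn.
apply/negPn/negP=> js; apply: no; rewrite -ltnS in jn; exists (Ordinal jn).
by rewrite missed_letter js.
Qed.

Lemma mono_word m n (s : {ffun 'I_m.+1 -> 'I_n.+1}) : mono s = sorted leq (word s).
Proof.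
apply/monoP/idP => [ms|sw x y xy].
  rewrite (sorted_pairwise leq_trans); apply/(pairwiseP 0) => x y.
  rewrite !inE size_word => xm ym xy.
  by rewrite (nth_word _ (Ordinal xm)) (nth_word _ (Ordinal ym)) ms //= ltnW.
rewrite -!nth_word; apply: (sorted_leq_nth leq_trans leqnn) => //; by rewrite inE size_word.
Qed.

Lemma spine_word m n (s : {ffun 'I_m.+1 -> 'I_n.+1}) :
  spine s = ~~ (full n (word s) && ~~ sorted leq (word s)).
Proof. by rewrite negb_and negbK -thick_bdry_word -mono_word orbC. Qed.

Lemma horn_vertex n (z : 'I_n.+1) : 0 < n -> horn z 0 [ffun _ => z].
Proof.
move=> n0; rewrite /horn mono_cst.
have [j jz] : exists j : 'I_n.+1, j != z.
  have [->|z0] := eqVneq z ord0; last by exists ord0; rewrite eq_sym.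
  by exists ord_max; rewrite -val_eqE /= -lt0n.
apply/existsP; exists j; rewrite jz; apply/forallP=> x.
by rewrite ffunE eq_sym.
Qed.

(** Goodness gives a map in [W] to [A] from an object with the universal property of [N], and the
    two objects are isomorphic over [A]. Of [A] itself only joint monicity of [g] and [h] is
    asked. *)
Lemma rel_represented (C : category) (W : morclass C) (X Y : sdata C) (f : simp_map X Y) n
    (S T : subcx n) (A : C) (g : fam X n A) (h : fam Y n A)
    (N : C) (nu : fam X n N) (b : hom N A) :
  stable_class W -> relrep W f S T -> cone S g -> cone T h ->
  (forall m s, S m s -> f m \c g m s = h m s) ->
  (forall B (x y : hom B A), (forall m s, S m s -> g m s \c x = g m s \c y) ->
     (forall m s, T m s -> h m s \c x = h m s \c y) -> x = y) ->
  cone T nu ->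
  (forall B (l : fam X n B), cone T l -> exists v : hom B N,
     forall m s, T m s -> nu m s \c v = l m s) ->
  (forall B (x y : hom B N), (forall m s, T m s -> nu m s \c x = nu m s \c y) -> x = y) ->
  subcx_le S T ->
  (forall m s, S m s -> nu m s = g m s \c b) -> (forall m s, T m s -> f m \c nu m s = h m s \c b) ->
  W _ _ b.
Proof.
move=> [Wi Wc _] R cg ch fgh Auniq cnu Nex Nuniq ST nug nuh.
have [P [c [g' [Wcc cg' e1 e2 [ex un]]]]] := R A g h cg ch fgh.
have [v nv] := Nex P g' cg'.
have [u [cu gu]] := ex N b nu cnu nug nuh.
rewrite -cu; apply: Wc => //; apply: Wi; exists v; split.
  by apply: Nuniq => m s Ts; rewrite comp_assoc nv // gu // comp_idr.
apply: un => [|m s Ts]; last by rewrite comp_assoc gu // nv // comp_idr.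
rewrite comp_assoc cu comp_idr; apply: Auniq => m s H.
  by rewrite comp_assoc -nug // nv ?e1 //; apply: ST.
by rewrite comp_assoc -nuh // -comp_assoc nv // e2.
Qed.

(** * Families in GG(X) as families in [X] on a thickening *)

Section ThickSimplices.
Variables (C : category) (X : sdata C) (Mp : forall n, mapobj X n (thick n)).

Lemma mu_GG m n (t : {ffun 'I_m.+1 -> 'I_n.+1}) q (s : {ffun 'I_q.+1 -> 'I_m.+1}) :
  mu (Mp m) s \c smap (GG Mp) t = mu (Mp n) (fcomp t s).
Proof.
apply: mlift_spec => // l l' s' u _ mu'; rewrite -fcompA.
by apply: (mu_cone _ _ _ _ (Mp n)).
Qed.

Lemma GG_eq n A (x y : hom A (mo (Mp n))) :
  (forall m (s : {ffun 'I_m.+1 -> 'I_n.+1}), mu (Mp n) s \c x = mu (Mp n) s \c y) -> x = y.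
Proof. by move=> e; apply: (m_uniq _ _ _ _ (Mp n)) => m s _; apply: e. Qed.

Lemma GG_simplicial : is_simplicial (GG Mp).
Proof.
split=> [m|m m' m'' t u mt mu'].
  by apply: GG_eq => q s; rewrite mu_GG comp_idr fcomp_idl.
by apply: GG_eq => q s; rewrite comp_assoc !mu_GG fcompA.
Qed.

Definition retraction m n (s : {ffun 'I_m.+1 -> 'I_n.+1}) : {ffun 'I_n.+1 -> 'I_n.+1} :=
  projT1 (cid (mono_retraction s)).

Lemma retractionP m n (s : {ffun 'I_m.+1 -> 'I_n.+1}) :
  [/\ mono (retraction s), fcomp (retraction s) s = s & forall y, exists x, retraction s y = s x].
Proof. exact: (projT2 (cid (mono_retraction s))). Qed.

(* [thickening S T]: [T] is the union of the thick simplices spanned by the faces in [S], so that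
   Map(S, GG) = Map(T, X). *)
Definition thickening n (S T : subcx n) : Prop :=
  [/\ forall m s, T m s -> S n (retraction s),
      forall m s, S m s -> mono s /\ T m s
    & forall m m' s (t : {ffun 'I_m'.+1 -> 'I_m.+1}), T m s -> T m' (fcomp s t)].

Lemma thickening_horn n (z : 'I_n.+1) : thickening (horn z) (thick_horn z).
Proof.
split=> [m s /existsP[j /andP[jz /forallP sj]]|m s|].
- have [mr _ im] := retractionP s; rewrite /horn mr; apply/existsP; exists j; rewrite jz.
  by apply/forallP=> y; have [x ->] := im y.
- by move=> /andP[].
- exact: thick_horn_comp.
Qed.

Lemma thickening_bdry n : thickening (bdry n) (@thick_bdry n).
Proof.
split=> [m s /existsP[j /forallP sj]|m s|].
- have [mr _ im] := retractionP s; rewrite /bdry mr; apply/existsP; exists j.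
  by apply/forallP=> y; have [x ->] := im y.
- by move=> /andP[].
- exact: thick_bdry_comp.
Qed.

Definition thicken n A (g : fam (GG Mp) n A) : fam X n A :=
  fun m s => mu (Mp n) s \c g n (retraction s).

Section Thicken.
Variables (n : nat) (S T : subcx n) (A : C) (g : fam (GG Mp) n A).
Hypotheses (ST : thickening S T) (cg : cone S g).

(** Any face in [S] that contains the letters of [s] gives the same value. This compares a simplex
    with its faces, whose letters may span less. *)
Lemma thicken_indep m (s : {ffun 'I_m.+1 -> 'I_n.+1}) (r : {ffun 'I_n.+1 -> 'I_n.+1}) :
  S r -> fcomp r (retraction s) = retraction s -> thicken g s = mu (Mp n) s \c g r.
Proof.
move=> Sr rs; have [mr rss _] := retractionP s.
by rewrite /thicken -rs cg // comp_assoc mu_GG rss.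
Qed.

Lemma fix_retraction m m' (s : {ffun 'I_m.+1 -> 'I_n.+1}) (t : {ffun 'I_m'.+1 -> 'I_m.+1}) :
  fcomp (retraction s) (retraction (fcomp s t)) = retraction (fcomp s t).
Proof.
have [_ rs _] := retractionP s; have [_ _ im] := retractionP (fcomp s t).
apply/ffunP=> y; rewrite fcompE; have [x ->] := im y; rewrite fcompE.
by move/ffunP/(_ (t x)): rs; rewrite fcompE.
Qed.

Lemma thicken_cone : cone T (thicken g).
Proof.
have [T1 _ _] := ST; move=> m m' s t Ts mt.
rewrite (thicken_indep (T1 _ _ Ts)) ?fix_retraction // /thicken comp_assoc.
by rewrite (mu_cone _ _ _ _ (Mp n)).
Qed.

Lemma thicken_cell m q (s : {ffun 'I_m.+1 -> 'I_n.+1}) (u : {ffun 'I_q.+1 -> 'I_m.+1}) :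
  S s -> thicken g (fcomp s u) = mu (Mp m) u \c g s.
Proof.
have [T1 S2 _] := ST; move=> Ss; have [ms Ts] := S2 _ _ Ss.
have [_ rs _] := retractionP s.
have -> : g s = smap (GG Mp) s \c g (retraction s) by rewrite -cg ?rs //; apply: T1.
by rewrite (thicken_indep (T1 _ _ Ts)) ?fix_retraction // comp_assoc mu_GG.
Qed.

Lemma thicken_thin m (s : {ffun 'I_m.+1 -> 'I_n.+1}) :
  S s -> thicken g s = mu (Mp m) (idf _) \c g s.
Proof. by move=> Ss; rewrite -[in LHS](fcomp_idr s) thicken_cell. Qed.

End Thicken.

Lemma thicken_monic n (S T : subcx n) (A : C) (g : fam (GG Mp) n A) B (x y : hom B A) :
  thickening S T -> cone S g ->
  (forall m s, T m s -> thicken g s \c x = thicken g s \c y) ->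
  forall m s, S m s -> g m s \c x = g m s \c y.
Proof.
move=> ST cg e m s Ss; apply: GG_eq => q u; have [_ S2 T3] := ST.
by rewrite !comp_assoc -!(thicken_cell ST cg) // e //; apply: T3; apply: (S2 _ _ Ss).2.
Qed.

Lemma thicken_canon n m (s : {ffun 'I_m.+1 -> 'I_n.+1}) :
  thicken (canon (GG Mp) n) s = mu (Mp n) s.
Proof. by rewrite /thicken /canon mu_GG; have [_ -> _] := retractionP s. Qed.

Lemma thicken_comp n A B (g : fam (GG Mp) n A) (b : hom B A) m (s : {ffun 'I_m.+1 -> 'I_n.+1}) :
  thicken (fcompm g b) s = thicken g s \c b.
Proof. by rewrite /thicken /fcompm comp_assoc. Qed.

Lemma thicken_eq n (S T : subcx n) A (g g' : fam (GG Mp) n A) :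
  thickening S T -> (forall m s, S m s -> g m s = g' m s) ->
  forall m s, T m s -> thicken g s = thicken g' s.
Proof. by move=> [T1 _ _] e m s /T1 Ts; rewrite /thicken e. Qed.

End ThickSimplices.

(** * Horn filling in GG(X) *)

Section RegularCategory.
Variables (C : category) (cov : morclass C) (k : nat) (X : sdata C).
Variable Mp : forall n, mapobj X n (thick n).
Hypotheses (Hd : descent_category cov) (Hs : subcanonical cov) (k0 : 0 < k).
Hypothesis HXk : k_category cov k X.

Let HC : has_finite_limits C := proj1 Hd.
Let HX : is_simplicial X := proj1 HXk.
Let Scov : stable_class cov := stable_cov Hd.
Let Siso : stable_class (@is_iso C) := @stable_iso C.

Variables (t : C) (Ht : is_terminal t).
Let pX : simp_map X (point t) := to_pt Ht X.
Let Hpt : is_simplicial (point t) := point_simplicial t.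
Let HpX : smor X (point t) pX := @to_pt_smor C t Ht X.

(** Horns are finite, so their mapping spaces exist and carry the filling hypothesis over to
    generalized points. *)
Lemma inner_cell_rel m (i : 'I_m.+1) : 0 < i < m ->
  cell_rel cov pX (horn i) /\ (k < m -> cell_rel (@is_iso C) pX (horn i)).
Proof.
move=> im; have [_ [Hh _]] := HXk.
have [|M _] := mapobj_ex Ht HC HX (@horn_vertex m i _) (@horn_closed m i) (@horn_simp m i).
  by lia.
have [cM iM] := Hh m i im M.
have qM := mlift_spec _ _ _ _ M _ _ (cone_le (@horn_simp m i) (cone_canon HX)).
split=> [|/iM isoM]; apply: (cell_rel_of_object HC _ (mapobj_object Ht M) qM) => //;
  exact: terminal_unique.
Qed.

Lemma rel_thick_horn n (z : 'I_n.+1) : 1 < n -> relrep cov pX (thick_horn z) (thick n).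
Proof.
move=> n1; have zn : z <= n by rewrite -ltnS.
apply: (rel_matching _ _ (thick_horn_matching n1 zn) HX Hpt HpX (k := k)) => //.
- by move=> m m' s u Ts _; apply: thick_horn_comp.
- by move=> m s; apply: thick_horn_word.
- by move=> m i im km; apply: (inner_cell_rel im).2.
- by move=> m i im; apply: (inner_cell_rel im).1.
Qed.

Lemma rel_thick_horn_iso n (z : 'I_n.+1) : 1 < n -> k < n ->
  relrep (@is_iso C) pX (thick_horn z) (thick n).
Proof.
move=> n1 kn; have zn : z <= n by rewrite -ltnS.
apply: (rel_matching_iso _ _ (thick_horn_matching n1 zn) HX Hpt HpX (k := k)) => //.
- by move=> m m' s u Ts _; apply: thick_horn_comp.
- by move=> m s; apply: thick_horn_word.
- by move=> m i im km; apply: (inner_cell_rel im).2.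
- by move=> l c r /thick_horn_matching_size/(_ zn); apply: leq_trans.
Qed.

Lemma rel_spine n : 1 < n -> relrep cov pX (@spine n) (thick n).
Proof.
move=> n1.
apply: (rel_matching _ _ (spine_matching n1) HX Hpt HpX (k := k)) => //.
- exact: spine_closed.
- by move=> m s; apply: spine_word.
- by move=> m i im km; apply: (inner_cell_rel im).2.
- by move=> m i im; apply: (inner_cell_rel im).1.
Qed.

Lemma thick_represented (W : morclass C) n (S : subcx n) P (g : fam X n P)
    (q : hom (mo (Mp n)) P) :
  stable_class W -> relrep W pX S (thick n) -> cone S g ->
  (forall B (x y : hom B P), (forall m s, S m s -> g m s \c x = g m s \c y) -> x = y) ->
  (forall m s, S m s -> mu (Mp n) s = g m s \c q) -> W _ _ q.
Proof.
move=> HW R cg gu gq.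
pose h : fam (point t) n P := fun m _ => to_terminal Ht P.
apply: (rel_represented (h := h) (nu := @mu _ _ _ _ (Mp n)) HW R cg) => //.
- by move=> *; apply: terminal_unique.
- by move=> *; apply: terminal_unique.
- by move=> B x y e _; apply: gu.
- exact: mu_cone.
- by move=> B l cl; exists (mlift (Mp n) l); apply: mlift_spec.
- by move=> B x y e; apply: GG_eq => m s; apply: e.
- by move=> *; apply: terminal_unique.
Qed.

Section Horn.
Variables (n : nat) (z : 'I_n.+1) (H : mapobj (GG Mp) n (horn z)).
Let q := mlift H (canon (GG Mp) n).

Lemma GG_horn_lift m s : horn z m s -> mu H s \c q = smap (GG Mp) s.
Proof.
apply: (mlift_spec _ _ _ _ H).
by apply: cone_le (@horn_simp n z) (cone_canon _); apply: GG_simplicial.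
Qed.

Lemma GG_horn_class (W : morclass C) : stable_class W ->
  relrep W pX (thick_horn z) (thick n) -> W _ _ q.
Proof.
move=> HW R; have th := thickening_horn z; have cH := mu_cone _ _ _ _ H.
apply: (thick_represented HW R (g := thicken (@mu _ _ _ _ H))).
- exact: thicken_cone th cH.
- move=> B x y e; apply: (m_uniq _ _ _ _ H); exact: thicken_monic th cH e.
move=> m s Ts; rewrite -thicken_canon -thicken_comp; apply: thicken_eq th _ _ _ Ts.
by move=> m' s' Ss; rewrite /fcompm GG_horn_lift.
Qed.

Lemma GG_horn_iso : 1 < n -> k < n -> is_iso q.
Proof. by move=> n1 kn; apply: GG_horn_class => //; apply: rel_thick_horn_iso. Qed.

End Horn.

Lemma thick_point_simp m (s : {ffun 'I_m.+1 -> 'I_1}) : mu (Mp 0) s = smap X s \c mu (Mp 0) (idf 1).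
Proof.
rewrite -(mu_cone _ _ _ _ (Mp 0)) ?fcomp_idl //.
by rewrite (to_point s) mono_collapse.
Qed.

Lemma thick_point_monic : monic (mu (Mp 0) (idf 1)).
Proof. by move=> A x y e; apply: GG_eq => m s; rewrite thick_point_simp -!comp_assoc e. Qed.

Definition swap : {ffun 'I_2 -> 'I_2} := [ffun x => rev_ord x].

Lemma swapK : fcomp swap swap = idf 2.
Proof. by apply/ffunP=> x; rewrite !ffunE rev_ordK. Qed.

(** The definition of a [k]-category speaks of one vertex; the automorphism of the thick edge that
    exchanges its ends gives the other. *)
Lemma GG1_vertex_cover (v : 'I_2) : cov (mu (Mp 1) ([ffun _ => v] : {ffun 'I_1 -> 'I_2})).
Proof.
have [_ [_ c0]] := HXk; have {}c0 := c0 (Mp 1).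
have [Wi Wc _] := Scov.
have [v0|v0] := eqVneq v ord0.
  by rewrite v0; exact: c0.
pose s := smap (GG Mp) swap.
have ss : s \c s = idm _.
  by apply: GG_eq => m u; rewrite comp_assoc !mu_GG -fcompA swapK fcomp_idl comp_idr.
suff -> : mu (Mp 1) ([ffun _ => v] : {ffun 'I_1 -> 'I_2}) = mu (Mp 1) const0 \c s.
  by apply: Wc => //; apply: Wi; exists s.
rewrite mu_GG; congr mu; apply/ffunP=> x; rewrite !ffunE; apply/val_inj.
by case: v v0 => [[|[|]]].
Qed.

(** A horn of dimension 1 is a single vertex, so its mapping space embeds into [X_0], and the
    composite is evaluation of thick edges at that vertex. *)
Lemma GG_horn1_cover (z : 'I_2) (H : mapobj (GG Mp) 1 (horn z)) :
  cov (mlift H (canon (GG Mp) 1)).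
Proof.
pose v : {ffun 'I_1 -> 'I_2} := [ffun _ => z].
have hv : horn z 0 v by apply: horn_vertex.
apply: (cov_through_monic_fst Hd Hs (j := mu (Mp 0) (idf 1) \c mu H v)).
  move=> A x y; rewrite -!comp_assoc => /thick_point_monic e.
  apply: (m_uniq _ _ _ _ H) => m s /andP[_ /existsP[j /andP[jz /forallP sj]]].
  have -> : s = fcomp v (collapse m).
    apply/ffunP=> l; rewrite fcompE ffunE; apply/val_inj.
    have := sj l; move: jz; rewrite -!val_eqE /=.
    by have := ltn_ord j; have := ltn_ord z; have := ltn_ord (s l); lia.
  by rewrite (mu_cone _ _ _ _ H) ?mono_collapse // -!comp_assoc e.
by rewrite -comp_assoc GG_horn_lift // mu_GG fcomp_idr; apply: GG1_vertex_cover.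
Qed.

Lemma GG_horn_cover n (z : 'I_n.+1) (H : mapobj (GG Mp) n (horn z)) :
  0 < n -> cov (mlift H (canon (GG Mp) n)).
Proof.
case: n z H => [//|[|n]] z H _; first exact: GG_horn1_cover.
by apply: GG_horn_class => //; apply: rel_thick_horn.
Qed.

(** * The hypercover onto the image, and horn filling in the image *)

Section Image.
Variables (G : sdata C) (p : simp_map (GG Mp) G) (i : simp_map G X).
Hypotheses (HG : is_simplicial G) (Hp : smor (GG Mp) G p) (Hi : smor G X i).
Hypothesis ip : forall n, i n \c p n = mu (Mp n) (idf n.+1).
Hypothesis p_cov : forall n, cov (p n).
Hypothesis i_monic : forall n, monic (i n).

Let HGG : is_simplicial (GG Mp) := GG_simplicial Mp.

Lemma p0_monic : monic (p 0).
Proof.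
move=> A x y e; apply: thick_point_monic.
by rewrite -ip -!comp_assoc e.
Qed.

(** The boundary consists of isolated points at most, and [p 0] is monic. Hence [P] embeds into
    [G_n], onto which [p n] is a cover. *)
Lemma image_hypercover_low n : n <= 1 -> forall P : relmap (GG Mp) G p n (bdry n) (simp n),
  cov (rlift P (canon (GG Mp) n) (fun m s => smap G s \c p n)).
Proof.
move=> n1 P; have [cg pg _ uq] := relmap_object HG P (@bdry_simp n).
have cc : cone (simp n) (canon (GG Mp) n) by apply: cone_canon.
have [|||_ e2] := rlift_spec _ _ _ _ _ _ _ P _ (canon (GG Mp) n) (fun m s => smap G s \c p n).
- exact: cone_le (@bdry_simp n) cc.
- exact: (cone_comp (p n) (cone_canon HG)).
- by move=> m s /bdry_simp ms; rewrite /canon Hp.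
have {}e2 := e2 n (idf _) (mono_idf _).
apply: (cov_through_monic_fst Hd Hs (j := rv _ _ _ _ _ _ _ P _ (idf n.+1))); last first.
  by rewrite e2 HG.1 comp_idl.
move=> A x y e; apply: uq => // m s bs.
have [v sv] : exists v : {ffun 'I_1 -> 'I_n.+1}, s = fcomp v (collapse m).
  have /andP[_ /existsP[j /forallP sj]] := bs.
  exists [ffun _ => s ord0]; apply/ffunP=> l; rewrite fcompE ffunE; apply/val_inj.
  have := sj l; have := sj ord0; rewrite -!val_eqE /=.
  have := ltn_ord j; have := ltn_ord (s ord0); have := ltn_ord (s l); move: n1; clear; lia.
have bv : bdry n _ v.
  have -> : v = fcomp s [ffun _ => ord0].
    by rewrite sv fcompA (to_point (fcomp _ _)) -(to_point (idf 1)) fcomp_idr.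
  by apply: bdry_closed bs _; apply: mono_cst.
have vxy : ru _ _ _ _ _ _ _ P _ v \c x = ru _ _ _ _ _ _ _ P _ v \c y.
  by apply: p0_monic; rewrite !comp_assoc pg // -!comp_assoc e.
by rewrite sv cg ?mono_collapse // -!comp_assoc vxy.
Qed.

Lemma image_hypercover_high n : 1 < n -> forall P : relmap (GG Mp) G p n (bdry n) (simp n),
  cov (rlift P (canon (GG Mp) n) (fun m s => smap G s \c p n)).
Proof.
move=> n1 P; have [cg pg _ uq] := relmap_object HG P (@bdry_simp n).
set u := (ru _ _ _ _ _ _ _ P) in cg pg uq *.
set y := (rv _ _ _ _ _ _ _ P _ _) in pg uq *.
have cc : cone (simp n) (canon (GG Mp) n) by apply: cone_canon.
have [|||e1 e2] := rlift_spec _ _ _ _ _ _ _ P _ (canon (GG Mp) n) (fun m s => smap G s \c p n).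
- exact: cone_le (@bdry_simp n) cc.
- exact: (cone_comp (p n) (cone_canon HG)).
- by move=> m s /bdry_simp ms; rewrite /canon Hp.
have {}e2 := e2 n (idf _) (mono_idf _).
set q := rlift _ _ _ in e1 e2 *.
have th := thickening_bdry n.
(* A point of [P] is a boundary in GG(X) with a filler in [G]. The boundary thickens, the filler
   becomes a simplex of [X] through [i], and both agree on the common part because [i] after [p] is
   evaluation; as [i] is monic, [g] retains all of [P]. *)
pose g : fam X n (ro _ _ _ _ _ _ _ P) := fun m s =>
  if thick_bdry s then thicken u s else smap X s \c (i n \c y).
have gS m s : mono s -> g m s = smap X s \c (i n \c y).
  move=> ms; rewrite /g; case: ifP => // bs.
  have Ss : bdry n _ s by rewrite /bdry ms.
  rewrite (thicken_thin th cg Ss) -ip -comp_assoc pg // !comp_assoc.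
  by rewrite Hi.
have gT m s : thick_bdry s -> g m s = thicken u s by rewrite /g => ->.
have cone_g : cone (@spine n) g.
  move=> m m' s v /orP[ms|bs] mv.
    by rewrite !gS ?mono_fcomp // HX.2 // -comp_assoc.
  by rewrite !gT ?thick_bdry_comp // (thicken_cone th cg).
apply: (thick_represented Scov (rel_spine n1) cone_g).
  move=> B a b e; apply: uq.
    apply: (thicken_monic th cg) => m s bs; rewrite -gT //; apply: e.
    by rewrite /spine bs orbT.
  apply: i_monic; have := e n (idf _); rewrite gS ?mono_idf // HX.1 comp_idl !comp_assoc; apply.
  by rewrite /spine mono_idf.
move=> m s; have [bs _|bs] := boolP (thick_bdry s).
  rewrite gT // -thicken_canon -thicken_comp; apply: (thicken_eq th) bs => m' s' Ss'.
  by rewrite /fcompm e1.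
rewrite /spine (negbTE bs) orbF => ms; rewrite gS // -!comp_assoc e2 HG.1 comp_idl ip.
by rewrite -(mu_cone _ _ _ _ (Mp n)) ?fcomp_idl.
Qed.

Lemma image_hypercover : hypercover cov (GG Mp) G p.
Proof.
move=> n P; have [n1|n1] := leqP n 1; first exact: image_hypercover_low.
exact: image_hypercover_high.
Qed.

Lemma image_cell_rel d : cell_rel cov p (bdry d).
Proof.
case: d => [|d]; first by apply: cell_rel_point.
have [||Q [g [y ob]]] := rel_object_ex HC HGG HG Hp (bdry_vertex d).
- exact: bdry_closed.
- exact: bdry_simp.
have [P _] := relmap_of_object HGG HG Hp (@bdry_simp d.+1) ob.
have [|||e1 e2] := rlift_spec _ _ _ _ _ _ _ P _ (canon (GG Mp) d.+1) (fun m s => smap G s \c p d.+1).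
- exact: cone_le (@bdry_simp _) (cone_canon HGG).
- exact: (cone_comp (p _) (cone_canon HG)).
- by move=> m s /bdry_simp ms; rewrite /canon Hp.
apply: (cell_rel_of_object HC Scov (relmap_object HG P (@bdry_simp _)) e1).
  by rewrite e2 ?HG.1 ?comp_idl //; apply: mono_idf.
exact: image_hypercover.
Qed.

Section ImageHorn.
Variables (n : nat) (z : 'I_n.+1) (M : mapobj G n (horn z)) (H : mapobj (GG Mp) n (horn z)).
Hypothesis n0 : 0 < n.
Let pH := mlift M (fun m s => p m \c mu H s).
Let qH := mlift H (canon (GG Mp) n).
Let qM := mlift M (canon G n).

Lemma image_horn_lift m s : horn z m s -> mu M s \c pH = p m \c mu H s.
Proof.
apply: (mlift_spec _ _ _ _ M) => m' m'' s' u Ss' mu'.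
by rewrite (mu_cone _ _ _ _ H) // !comp_assoc Hp.
Qed.

Lemma image_horn_canon m s : horn z m s -> mu M s \c qM = smap G s.
Proof. by apply: (mlift_spec _ _ _ _ M); apply: cone_le (@horn_simp n z) (cone_canon HG). Qed.

Lemma image_horn_square : qM \c p n = pH \c qH.
Proof.
apply: (m_uniq _ _ _ _ M) => m s Ss; have ms := horn_simp Ss.
rewrite !comp_assoc image_horn_canon // image_horn_lift //.
by rewrite -comp_assoc GG_horn_lift // Hp.
Qed.

(** The horn grows from one vertex by cells attached along boundaries, each a cover by the
    hypercover property; over the vertex itself [p 0] is an isomorphism with inverse [d]. *)
Lemma image_horn_cover : cov pH.
Proof.
have [d [dp pd]] := cov_monic_iso Hs (p_cov 0) p0_monic.
pose v : {ffun 'I_1 -> 'I_n.+1} := [ffun _ => z].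
have hv : horn z 0 v by apply: horn_vertex.
have vS : subcx_le (cell v) (horn z) by move=> m s /cellP[u [mu' ->]]; apply: horn_closed.
have R : relrep cov p (cell v) (horn z).
  apply: rel_thin => //; first exact: cell_closed.
  - exact: horn_closed.
  - exact: horn_simp.
  by move=> d' w _ _ _; apply: image_cell_rel.
pose g : fam (GG Mp) n (mo M) := fun m _ => smap (GG Mp) (collapse m) \c (d \c mu M v).
have cM := mu_cone _ _ _ _ M; have cH := mu_cone _ _ _ _ H.
apply: (rel_represented (g := g) (h := @mu _ _ _ _ M) (nu := @mu _ _ _ _ H) Scov R) => //.
- move=> m m' s u _ mu'; rewrite /g [RHS]comp_assoc -HGG.2 ?mono_collapse //.
  by rewrite (to_point (fcomp _ _)).
- move=> m s /cellP[u [mu' ->]]; rewrite /g (cM _ _ _ _ hv mu') (to_point u).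
  by rewrite comp_assoc Hp ?mono_collapse // -!comp_assoc (comp_assoc (p 0)) pd comp_idl.
- by move=> B x y _ e; apply: (m_uniq _ _ _ _ M).
- by move=> B l cl; exists (mlift H l); apply: mlift_spec.
- by move=> B x y e; apply: (m_uniq _ _ _ _ H).
- move=> m s /cellP[u [mu' ->]]; rewrite /g (cH _ _ _ _ hv mu') (to_point u).
  rewrite -!comp_assoc image_horn_lift // (comp_assoc d) dp comp_idl //.
- by move=> m s Ss; rewrite image_horn_lift.
Qed.

Lemma image_horn_filler_cover : cov qM.
Proof.
have [_ Wc _] := Scov; apply: (cov_cancel Hd (f := p n)) => //.
rewrite image_horn_square; apply: Wc; first exact: GG_horn_cover.
exact: image_horn_cover.
Qed.

Lemma image_horn_filler_iso : k < n -> is_iso qM.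
Proof.
(* As [k] is positive, [k < n] excludes the exceptional dimension 1. *)
move=> kn; have n1 : 1 < n by apply: leq_ltn_trans kn.
have [r [rq qr]] := GG_horn_iso H n1 kn.
apply: (cov_monic_iso Hs) image_horn_filler_cover _.
move=> A a b ab.
have [U [c [l [cc pl]]]] := cov_local_lift Hd (qM \c a) image_horn_cover.
apply: (cov_epic Hs cc).
(* Over a cover the horn lifts to [l] in GG(X). Any filler [x] in [G] then lifts locally, relative
   to that horn, along the hypercover; the lift is the unique filler [r \c l], so [x] is determined
   by [l]. *)
suff key (x : hom A (sob G n)) : pH \c l = qM \c x \c c -> x \c c = p n \c r \c l.
  by rewrite (key a) // (key b) // -ab.
move=> e.
have R : relrep cov p (horn z) (simp n).
  apply: rel_thin => //.
  - exact: horn_closed.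
  - exact: simp_closed.
  - exact: horn_simp.
  by move=> d' w _ _ _; apply: image_cell_rel.
have [|||P [c2 [g' [cc2 cg' e1 e2 _]]]] :=
  R U (fcompm (@mu _ _ _ _ H) l) (fcompm (canon G n) (x \c c)).
- exact: (cone_comp l (mu_cone _ _ _ _ H)).
- exact: cone_comp (cone_canon HG).
- move=> m s Ss; rewrite /fcompm comp_assoc -image_horn_lift // -comp_assoc e !comp_assoc.
  by rewrite image_horn_canon.
apply: (cov_epic Hs cc2); have mid := mono_idf n.+1.
have := e2 n _ mid; rewrite /fcompm /canon HG.1 comp_idl => <-.
rewrite -!comp_assoc; congr (_ \c _).
have <- : qH \c g' n (idf _) = l \c c2.
  apply: (m_uniq _ _ _ _ H) => m s Ss; have ms := horn_simp Ss.
  by rewrite !comp_assoc GG_horn_lift // -cg' // fcomp_idl e1.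
by rewrite comp_assoc rq comp_idl.
Qed.

End ImageHorn.

Lemma image_groupoid : k_groupoid cov k G.
Proof.
split=> // n z n0 M.
have [H _] := mapobj_ex Ht HC HGG (horn_vertex z n0) (@horn_closed n z) (@horn_simp n z).
split; first exact: image_horn_filler_cover M H n0.
exact: image_horn_filler_iso M H n0.
Qed.

End Image.
End RegularCategory.

Theorem theorem7p5 (C : category) (cov reg : morclass C) (k : nat) (X : sdata C)
  (Mp : forall n, mapobj X n (thick n))
  (Gob : nat -> C) (p : forall n, hom (mo (Mp n)) (Gob n))
  (i : forall n, hom (Gob n) (sob X n)) :
  regular_descent_category cov reg ->
  0 < k ->
  regular_k_category cov reg k X ->
  (forall n (M : mapobj X n (thick n)), reg _ _ (mu M (idf n.+1))) ->
  (forall n, is_coimage (mu (Mp n) (idf n.+1)) (p n) /\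
             compm (i n) (p n) = mu (Mp n) (idf n.+1)) ->
  exists gm : forall m m', {ffun 'I_m'.+1 -> 'I_m.+1} -> hom (Gob m) (Gob m'),
    let G := @SData C Gob gm in
    is_simplicial G /\
    (forall m m' (t : {ffun 'I_m'.+1 -> 'I_m.+1}), mono t ->
       compm (i m') (gm m m' t) = compm (smap X t) (i m)) /\
    smor (GG Mp) G p /\
    k_groupoid cov k G /\
    hypercover cov (GG Mp) G p.
Proof.
move=> [Hd [Hs [_ [_ [_ coim]]]]] k0 [HXk _] regM pi.
have HX : is_simplicial X := proj1 HXk.
have HGG := GG_simplicial Mp.
have p_cov n : cov _ _ (p n).
  have [z [p' [cp' cov']]] := coim _ _ _ (regM n (Mp n)).
  exact: (coimage_cov Hd (pi n).1 cp' cov').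
have i_monic n : monic (i n).
  exact: (coimage_image_monic Hd Hs (pi n).1 (pi n).2 (p_cov n)).
have mu_smap m m' (t : {ffun 'I_m'.+1 -> 'I_m.+1}) : mono t ->
    mu (Mp m') (idf _) \c smap (GG Mp) t = smap X t \c mu (Mp m) (idf _).
  by move=> mt; rewrite mu_GG -(mu_cone _ _ _ _ (Mp m)) // fcomp_idl fcomp_idr.
have desc m m' (t : {ffun 'I_m'.+1 -> 'I_m.+1}) : exists h : hom (Gob m) (Gob m'),
    mono t -> h \c p m = p m' \c smap (GG Mp) t.
  have mdesc (u : {ffun 'I_m'.+1 -> 'I_m.+1}) : mono u -> exists h : hom (Gob m) (Gob m'),
      h \c p m = p m' \c smap (GG Mp) u.
    (* As [i] is monic, whatever evaluation into [X_m] identifies is also identified by [p m'] after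
       the structure map, so this composite descends to the coimage. *)
    move=> mu'; apply: (coimage_factor (pi m).1) => K a b ab; apply: i_monic.
    by rewrite !comp_assoc (pi m').2 mu_smap // -!comp_assoc ab.
  have [mt|nt] := boolP (mono t); first by have [h hp] := mdesc t mt; exists h.
  (* [gm] is total although only monotone maps act; for the others, the action of a constant map
     serves as default value. *)
  by have [h _] := mdesc _ (mono_cst _ ord0); exists h.
pose gm m m' t := projT1 (cid (desc m m' t)).
have gmP m m' t : mono t -> gm m m' t \c p m = p m' \c smap (GG Mp) t.
  exact: (projT2 (cid (desc m m' t))).
exists gm; set G := SData gm.
have HG : is_simplicial G.
  split=> [m|m m' m'' t u mt mu'] /=; apply: (cov_epic Hs (p_cov m)).
    by rewrite gmP ?mono_idf // HGG.1 comp_idr comp_idl.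
  by rewrite gmP ?mono_fcomp // HGG.2 // comp_assoc -gmP // -!comp_assoc -gmP.
have Hp : smor (GG Mp) G p by move=> m m' t mt /=; rewrite gmP.
have Hi : smor G X i.
  move=> m m' t mt /=; apply: (cov_epic Hs (p_cov m)).
  by rewrite -!comp_assoc gmP // (pi m).2 comp_assoc (pi m').2 mu_smap.
have [t0 Ht] := (proj1 Hd).1; have ip n := (pi n).2.
split=> //; split; first exact: Hi.
split=> //; split.
  exact: (image_groupoid Hd Hs k0 HXk Ht HG Hp Hi ip p_cov i_monic).
exact: (image_hypercover Hd Hs k0 HXk Ht HG Hp Hi ip p_cov i_monic).
Qed.
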